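(* For every positive integer $r$ there exists a function $\operatorname{sign}_r : \operatorname{Par}_r \to \{1,-1\}$ such that, for every positive integer $n$, every $r$-partite partition $\boldsymbol{\lambda}=(\lambda^{(0)},\ldots,\lambda^{(r-1)})$ of $n$ and every composition $\mu = (\mu_1,\ldots,\mu_t)$ of $n$, \[ \psi^{(\lambda^{(0)},\ldots,\lambda^{(r-1)})}_{(\mu,\varnothing,\ldots,\varnothing)} = \operatorname{sign}_r(\lambda)\cdot \chi^\lambda_{r\mu}, \] where $\psi^{(\lambda^{(0)},\ldots,\lambda^{(r-1)})}$ is the irreducible character of $\mathbb{Z}_r \wr S_n$ indexed by $(\lambda^{(0)},\ldots,\lambda^{(r-1)})$, $\chi^\lambda$ is the irreducible character of $S_{rn}$ indexed by $\lambda := \varphi_r(\lambda^{(0)}, \ldots, \lambda^{(r-1)}) \in \operatorname{Par}_r$, and $r\mu := (r\mu_1,\dots,r\mu_t)$.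
   Context: **Partitions.** A composition of a non-negative integer $n$ is a finite sequence of positive integers with sum $n$; it is a partition if it is weakly decreasing. $\operatorname{Par}$ is the set of all partitions of all non-negative integers (including the empty partition $\varnothing$). An $r$-partite partition of $n$ is an $r$-tuple $(\lambda^{(0)},\ldots,\lambda^{(r-1)})$ of partitions whose sizes sum to $n$. Diagrams are drawn in the English convention (left-justified rows, weakly decreasing from top to bottom). A ribbon is a nonempty connected skew shape containing no $2\times 2$ square; its length is its number of cells. Peeling a ribbon from $\lambda$ means passing to a partition $\lambda'\subset\lambda$ such that the skew diagram $\lambda\setminus\lambda'$ is a ribbon. $\operatorname{Par}_r$ is the set of partitions with empty $r$-core, i.e. those that can be reduced to $\varnothing$ by some sequence of peelings of ribbons of length $r$. **Boundary sequence.** For a partition $\lambda$, $\partial(\lambda)$ is the $0/1$ sequence obtained by walking along the southeastern boundary of the diagram from its southwestern corner to its northeastern corner, writing $1$ for each horizontal (east) step and $0$ for each vertical (north) step; $\partial(\varnothing)$ is the empty sequence. The anchor of a finite $0/1$ sequence is the unique position between (or before/after) entries such that the number of $1$'s preceding it equals the number of $0$'s succeeding it. **The map $\varphi_r:\operatorname{Par}^r\to\operatorname{Par}$.** Given $(\lambda^{(0)},\ldots,\lambda^{(r-1)})$, add leading $0$'s and trailing $1$'s to the sequences $\partial(\lambda^{(0)}),\ldots,\partial(\lambda^{(r-1)})$ so that the resulting sequences $s^{(0)},\ldots,s^{(r-1)}$ have the same length $t$ and the same anchor position. Interlace them as $s_1^{(0)}, s_1^{(1)},\ldots,s_1^{(r-1)},s_2^{(0)},\ldots,s_2^{(r-1)},\ldots,s_t^{(0)},\ldots,s_t^{(r-1)}$,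 and let $\varphi_r(\lambda^{(0)},\ldots,\lambda^{(r-1)})$ be the unique partition whose boundary sequence is this sequence with leading $0$'s and trailing $1$'s removed. The map is well defined and injective, its image is $\operatorname{Par}_r$, and $|\varphi_r(\lambda^{(0)},\ldots,\lambda^{(r-1)})| = r\sum_j|\lambda^{(j)}|$. **Wreath product and characters.** $\mathbb{Z}_r\wr S_n$ is the group of permutations $\pi$ of $\{1,\ldots,n\}\times\mathbb{Z}_r$ that are $\mathbb{Z}_r$-equivariant (if $\pi(i,z)=(j,y)$ then $\pi(i,z+x)=(j,y+x)$ for all $x \in \mathbb{Z}_r$). Writing $\pi(i,0)=(\sigma(i),z_i)$, $\pi$ is encoded by $\sigma\in S_n$ and $(z_1,\ldots,z_n)\in\mathbb{Z}_r^n$. A cycle $(i_1,\ldots,i_k)$ of $\sigma$ has color $z_{i_1}+\cdots+z_{i_k}\in\mathbb{Z}_r$. The conjugacy class of $\pi$ is determined by the $r$-partite partition whose $j$-th component ($0\le j\le r-1$) records the lengths of the cycles of color $j$; thus type $(\mu,\varnothing,\ldots,\varnothing)$ means that all cycles have color $0$ and their lengths are the parts of $\mu$ (in any order). For a partition $\lambda$ of $m$, $\chi^\lambda$ is the usual irreducible character of $S_m$, and $\chi^\lambda_\nu$ is its value on permutations whose cycle lengths are the parts of $\nu$ (in any order). With $\omega=e^{2\pi i/r}$ and $n_j=|\lambda^{(j)}|$, the irreducible character $\psi^{(\lambda^{(0)},\ldots,\lambda^{(r-1)})}$ is the character induced to $\mathbb{Z}_r\wr S_n$, from the block subgroup $\prod_{j=0}^{r-1}(\mathbb{Z}_r\wr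 S_{n_j})$, of the product over $j$ of the characters $(\sigma,(z_1,\ldots,z_{n_j}))\mapsto \omega^{j(z_1+\cdots+z_{n_j})}\chi^{\lambda^{(j)}}(\sigma)$. A subscript denotes evaluation at an element of the conjugacy class of that type. *)

(* Defs.v *)
From mathcomp Require Import all_boot all_order all_algebra.
From mathcomp Require Import all_fingroup all_solvable all_field all_character.

Set Implicit Arguments.
Unset Strict Implicit.
Unset Printing Implicit Defensive.

Import GRing.Theory Num.Theory.
Local Open Scope nat_scope.

Definition is_composition (n : nat) (mu : seq nat) : bool :=
  (0 \notin mu) && (sumn mu == n).

Definition is_part (la : seq nat) : bool := sorted geq la && (0 \notin la).

Definition is_multipart (r n : nat) (la : r.-tuple (seq nat)) : bool :=
  all is_part la && (sumn (map sumn la) == n).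

(* The cell in row i and column j (both numbered from 0, English convention)
   is the pair (i, j). *)
Definition skew_cells (la mu : seq nat) : seq (nat * nat) :=
  [seq (i, j) | i <- iota 0 (size la),
                j <- iota (nth 0 mu i) (nth 0 la i - nth 0 mu i)].

Definition adjacent (c d : nat * nat) : bool :=
     (c.1 == d.1) && ((c.2.+1 == d.2) || (d.2.+1 == c.2))
  || (c.2 == d.2) && ((c.1.+1 == d.1) || (d.1.+1 == c.1)).

Definition connected (D : seq (nat * nat)) : Prop :=
  forall c d, c \in D -> d \in D ->
  exists p : seq (nat * nat),
    [/\ path adjacent c p, {subset p <= D} & last c p = d].

Definition has_square (D : seq (nat * nat)) : Prop :=
  exists i j, [/\ (i, j) \in D, (i.+1, j) \in D,
                  (i, j.+1) \in D & (i.+1, j.+1) \in D].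

Definition ribbon (D : seq (nat * nat)) : Prop :=
  [/\ D <> [::], connected D & ~ has_square D].

Definition peel (r : nat) (la la' : seq nat) : Prop :=
  [/\ is_part la, is_part la', forall i, nth 0 la' i <= nth 0 la i,
      ribbon (skew_cells la la') & size (skew_cells la la') = r].

Inductive Par_r (r : nat) : seq nat -> Prop :=
  | Par_r_nil : Par_r r [::]
  | Par_r_peel la la' : peel r la la' -> Par_r r la' -> Par_r r la.

(* In 0/1 sequences, 1 (an east step) is [true] and 0 (a north step) is
   [false]. The walk starts at the bottom row, i.e. at the end of la. *)
Fixpoint boundary (la : seq nat) : bitseq :=
  if la is a :: la' then
    boundary la' ++ nseq (a - head 0 la') true ++ [:: false]
  else [::].

Definition anchor (s : bitseq) : nat :=
  find (fun k => count_mem true (take k s) == count_mem false (drop k s))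
       (iota 0 (size s).+1).

(* A leading 0 moves the anchor one step to the right, a trailing 1 leaves it
   unchanged; [pad_all] puts every anchor at the largest one, and then extends
   every sequence to the largest resulting length. *)
Definition pad (a b : nat) (s : bitseq) : bitseq :=
  nseq (a - anchor s) false ++ s ++ nseq (b - (size s - anchor s)) true.

Definition pad_all (ss : seq bitseq) : seq bitseq :=
  map (pad (\max_(s <- ss) anchor s) (\max_(s <- ss) (size s - anchor s))) ss.

Definition interlace (ss : seq bitseq) : bitseq :=
  flatten [seq [seq nth false s k | s <- ss]
          | k <- iota 0 (\max_(s <- ss) size s)].

Definition trim (s : bitseq) : bitseq :=
  let s1 := drop (find id s) s in
  rev (drop (find negb (rev s1)) (rev s1)).

(* Inverse of [boundary]: each 0 is the end of a row, whose length is the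
   number of 1's before that 0. *)
Definition of_boundary (w : bitseq) : seq nat :=
  rev [seq count_mem true (take k w)
      | k <- iota 0 (size w) & ~~ nth true w k].

Definition phi (ls : seq (seq nat)) : seq nat :=
  of_boundary (trim (interlace (pad_all (map boundary ls)))).

Lemma of_boundary_rcons w b :
  of_boundary (rcons w b) =
    if b then of_boundary w else count_mem true w :: of_boundary w.
Proof.
rewrite /of_boundary size_rcons -addn1 iotaD add0n /= filter_cat map_cat rev_cat.
rewrite /= nth_rcons ltnn eqxx.
have -> : [seq count_mem true (take k (rcons w b))
          | k <- iota 0 (size w) & ~~ nth true (rcons w b) k] =
    [seq count_mem true (take k w) | k <- iota 0 (size w) & ~~ nth true w k].
  rewrite (_ : [seq k <- _ | _] =
     [seq k <- iota 0 (size w) | ~~ nth true w k]); last first.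
    by apply: eq_in_filter => k; rewrite mem_iota /= add0n nth_rcons => ->.
  apply/eq_in_map => k; rewrite mem_filter mem_iota /= add0n => /andP[_ kw].
  by rewrite -cats1 takel_cat // ltnW.
by case: b => //=; rewrite -cats1 take_size_cat.
Qed.

Lemma boundary_of_boundary w :
  boundary (of_boundary w) ++
    nseq (count_mem true w - head 0 (of_boundary w)) true = w.
Proof.
suff: head 0 (of_boundary w) <= count_mem true w /\
  boundary (of_boundary w) ++
    nseq (count_mem true w - head 0 (of_boundary w)) true = w by case.
elim/last_ind: w => [//|w b [le_w IH]].
rewrite of_boundary_rcons -cats1 count_cat; case: b => /=; last first.
  by rewrite !addn0 subnn cats0 catA IH.
split; first by rewrite (leq_trans le_w) ?leq_addr.
by rewrite -addnBAC // addn0 addn1 -addn1 nseqD catA IH.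
Qed.

Lemma trimP s : trim s = [::] \/ exists w, trim s = rcons (true :: w) false.
Proof.
rewrite /trim /=; move s1E: (drop (find id s) s) => s1.
move s2E: (drop _ (rev s1)) => s2.
have [-> | [t s2t]] : s2 = [::] \/ exists t, s2 = false :: t.
  rewrite -{}s2E; elim: (rev s1) => [|[] u IH] /=;
  [by left | exact: IH | by right; exists u].
  by left.
right; have [s10 | [u s1u]] : s1 = [::] \/ exists u, s1 = true :: u.
  rewrite -{}s1E; elim: s {s2E} => [|[] s IH] /=;
  [by left | by right; exists s | exact: IH].
  by move: s2E; rewrite s10 s2t.
have: exists v, s1 = rcons (rev t) false ++ v.
  exists (rev (take (find negb (rev s1)) (rev s1))).
  by rewrite -rev_cons -s2t -s2E -rev_cat cat_take_drop revK.
case=> v; rewrite s1u s2t rev_cons; case: (rev t) => [//|x w] [<- _].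
by exists w.
Qed.

(* [phi ls] is the partition with the prescribed boundary sequence. *)
Lemma phi_boundary ls :
  boundary (phi ls) = trim (interlace (pad_all (map boundary ls))).
Proof.
rewrite /phi; set s := interlace _; have := boundary_of_boundary (trim s).
case: (trimP s) => [->|[w ->]] //.
by rewrite of_boundary_rcons -cats1 count_cat /= !addn0 subnn cats0.
Qed.

Lemma phi_part ls : is_part (phi ls).
Proof.
rewrite /phi; set s := interlace _.
case: (trimP s) => [->|[w ->]] //.
have H u : [/\ sorted geq (of_boundary (true :: u)), 0 \notin of_boundary (true :: u)
     & head 0 (of_boundary (true :: u)) <= count_mem true (true :: u)].
  elim/last_ind: u => [//|u b]; rewrite -rcons_cons of_boundary_rcons.
  set v := true :: u => -[so no le].
  case: b; last first.
    split=> [|| /=]; last by rewrite -cats1 count_cat leq_addr.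
      by move: so le; case: (of_boundary v) => //= a l -> ->.
    by rewrite inE negb_or no andbT.
  by split=> //; rewrite -cats1 count_cat (leq_trans le) ?leq_addr.
by rewrite /is_part; have [] := H (rcons w false) => -> ->.
Qed.

(* The irreducible character of S_m indexed by a partition la of m, as the
   character afforded by the Specht module: the right ideal generated by the
   Young symmetrizer in the group algebra (on which the group acts by right
   multiplication). The points of 'I_m label the cells of la row by row. *)
Definition row_stab (m : nat) (la : seq nat) : {set 'S_m} :=
  [set s : 'S_m |
    [forall i : 'I_m, reshape_index la (s i) == reshape_index la i]].

Definition col_stab (m : nat) (la : seq nat) : {set 'S_m} :=
  [set s : 'S_m |
    [forall i : 'I_m, reshape_offset la (s i) == reshape_offset la i]].

Definition young_symm (m : nat) (la : seq nat) : 'rV[algC]_(gcard [set: 'S_m]) :=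
  (\sum_(p in row_stab m la) \sum_(q in col_stab m la)
     (-1) ^+ q *: delta_mx 0 (gring_index [set: 'S_m] (p * q)%g))%R.

Definition chi (m : nat) (la : seq nat) : 'CF([set: 'S_m]) :=
  cfRepr (submod_repr
    (cyclic_mx_module (regular_repr algC [set: 'S_m]) (young_symm m la))).

Definition cycle_lengths (T : finType) (s : {perm T}) : seq nat :=
  [seq #|c| | c : {set T} <- enum (porbits s)].

(* f as a permutation (the identity if f is not injective) *)
Definition perm_of_fun (T : finType) (f : T -> T) : {perm T} :=
  insubd (1 : {perm T})%g [ffun x => f x].

(* The restriction of s to a stable set B, with the elements of B relabelled
   in order by 'I_#|B|. *)
Definition restrict (T : finType) (B : {set T}) (s : {perm T}) : 'S_#|B| :=
  perm_of_fun (fun k => enum_rank_in (enum_valP k) (s (enum_val k))).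

(* For r > 0 this is 'I_r with addition modulo r. *)
Notation Zmod r := 'I_r.-1.+1.

Section Wreath.

Variables (r n : nat).
Local Notation wperm := {perm 'I_n * Zmod r}.
Implicit Types p q u v : wperm.

Definition wreath : {set wperm} :=
  [set p : wperm | [forall i, forall z, forall x,
    p (i, z + x)%R == ((p (i, z)).1, (p (i, z)).2 + x)%R]].

Definition base (p : wperm) : 'S_n := perm_of_fun (fun i => (p (i, 0%R)).1).

Definition color (p : wperm) (i : 'I_n) : Zmod r := (p (i, 0%R)).2.

(* The lengths of the cycles of color j: this is component j of the type of p. *)
Definition wcycle_lengths (p : wperm) (j : Zmod r) : seq nat :=
  [seq #|c| | c : {set 'I_n} <- enum (porbits (base p))
                         & (\sum_(i in c) color p i)%R == j].

(* The consecutive intervals of lengths |la^(0)|, ..., |la^(r-1)| *)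
Definition block (la : r.-tuple (seq nat)) (j : 'I_r) : {set 'I_n} :=
  [set i : 'I_n | reshape_index (map sumn la) i == j].

Definition block_subgroup (la : r.-tuple (seq nat)) : {set wperm} :=
  [set p in wreath | [forall j, base p @: block la j == block la j]].

Lemma wreathP (p : wperm) : reflect
  (forall i z x, p (i, z + x)%R = ((p (i, z)).1, (p (i, z)).2 + x)%R)
  (p \in wreath).
Proof.
rewrite inE; apply: (iffP forallP) => [H i z x | H i].
  by have /forallP/(_ z)/forallP/(_ x)/eqP := H i.
by apply/forallP=> z; apply/forallP=> x; rewrite H.
Qed.

Lemma wreath_group_set : group_set wreath.
Proof.
apply/group_setP; split=> [|p q /wreathP Hp /wreathP Hq].
  by apply/wreathP=> i z x; rewrite !perm1.
by apply/wreathP=> i z x; rewrite !permM Hp Hq; case: (p (i, z)).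
Qed.
Canonical wreath_group := Group wreath_group_set.

Lemma perm_of_funE (T : finType) (f : T -> T) :
  injective f -> perm_of_fun f =1 f.
Proof.
move=> fI x; rewrite /perm_of_fun -pvalE val_insubd ifT ?ffunE //.
by apply/injectiveP=> y z; rewrite !ffunE => /fI.
Qed.

Lemma wreathE p i z : p \in wreath ->
  p (i, z) = ((p (i, 0%R)).1, color p i + z)%R.
Proof. by move=> /wreathP pW; rewrite -{1}[z]add0r pW. Qed.

Lemma baseE p i : p \in wreath -> base p i = (p (i, 0%R)).1.
Proof.
move=> pW; rewrite /base perm_of_funE // => i1 i2 E.
have /(congr1 fst) // : (i1, - color p i1)%R = (i2, - color p i2)%R.
by apply: (@perm_inj _ p); rewrite [LHS]wreathE // [RHS]wreathE // E !addrN.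
Qed.

Lemma baseM : {in wreath &, {morph base : p q / (p * q)%g}}.
Proof.
move=> p q pW qW; apply/permP=> i; rewrite permM !baseE ?groupM // permM.
by rewrite [p _]wreathE // wreathE.
Qed.

Lemma base1 : base 1 = 1%g.
Proof. by apply/permP=> i; rewrite baseE ?group1 // !perm1. Qed.

Lemma colorM p q i : p \in wreath -> q \in wreath ->
  color (p * q)%g i = (color p i + color q (base p i))%R.
Proof.
move=> pW qW; rewrite {1}/color permM [p _]wreathE // wreathE //=.
by rewrite addr0 addrC baseE.
Qed.

Lemma block_subgroup_group_set la : group_set (block_subgroup la).
Proof.
apply/group_setP; split=> [|p q].
  apply/setIdP; split; first exact: group1.
  apply/forallP=> j; rewrite base1.
  by rewrite (eq_imset _ (@perm1 _)) imset_id.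
case/setIdP=> pW /forallP Hp /setIdP[qW /forallP Hq].
apply/setIdP; split; first by rewrite groupM.
apply/forallP=> j; rewrite baseM //.
by rewrite (eq_imset _ (permM _ _)) imset_comp (eqP (Hp j)) Hq.
Qed.
Canonical block_subgroup_group la := Group (block_subgroup_group_set la).

(* e^(2 pi i / r): the root r.-root (-1) is e^(pi i / r) when r > 1, and is -1
   when r = 1. *)
Definition omega : algC := (r.-root (-1) ^+ 2)%R.

Definition block_char_fun (la : r.-tuple (seq nat)) (p : wperm) : algC :=
  (\prod_(j < r)
     (omega ^+ (j * (\sum_(i in block la j) color p i)%R)%N
      * chi #|block la j| (tnth la j) (restrict (block la j) (base p))))%R.

Lemma omegaX : 0 < r -> (omega ^+ r = 1)%R.
Proof. by move=> r0; rewrite /omega -exprM mulnC exprM rootCK // sqrrN expr1n. Qed.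

Lemma restrictE (B : {set 'I_n}) (s : 'S_n) k : s @: B = B ->
  enum_val (restrict B s k) = s (enum_val k).
Proof.
move=> sB; have sBk h : s (@enum_val _ (mem B) h) \in B.
  by have := imset_f s (enum_valP h); rewrite sB.
rewrite perm_of_funE => [|k1 k2]; first by rewrite enum_rankK_in.
move=> /(congr1 enum_val); rewrite !enum_rankK_in // => /perm_inj.
exact: enum_val_inj.
Qed.

Lemma restrictM (B : {set 'I_n}) (s t : 'S_n) : s @: B = B -> t @: B = B ->
  restrict B (s * t)%g = (restrict B s * restrict B t)%g.
Proof.
move=> sB tB; have stB : (s * t)%g @: B = B.
  by rewrite (eq_imset _ (permM _ _)) imset_comp sB tB.
by apply/permP=> k; apply: enum_val_inj; rewrite permM !restrictE // permM.
Qed.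

Lemma block_char_subproof la : is_class_fun <<block_subgroup la>>%g
  [ffun p => (block_char_fun la p *+ (p \in block_subgroup la))%R].
Proof.
rewrite genGid; apply: intro_class_fun => [p q pH qH | p /negbTE-> //].
rewrite groupJr //; congr (_ *+ _)%R; apply: eq_bigr => j _.
have sub u : u \in block_subgroup la ->
    u \in wreath /\ base u @: block la j = block la j.
  by case/setIdP=> -> /forallP/(_ j)/eqP.
set B := block la j in sub *; pose S u := (\sum_(i in B) color u i)%R.
have SM u v : u \in block_subgroup la -> v \in block_subgroup la ->
    S (u * v)%g = (S u + S v)%R.
  move=> /sub[uW uB] /sub[vW _]; rewrite /S.
  rewrite (eq_bigr _ (fun i _ => colorM i uW vW)) big_split /=; congr (_ + _)%R.
  by rewrite -[in RHS]uB big_imset //= => ? ? _ _ /perm_inj.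
have RM u v : u \in block_subgroup la -> v \in block_subgroup la ->
    restrict B (base (u * v)%g) = (restrict B (base u) * restrict B (base v))%g.
  by move=> /sub[uW uB] /sub[vW vB]; rewrite baseM // restrictM.
have pqH : (p ^ q)%g \in block_subgroup la by rewrite groupJ.
have E : (q * p ^ q = p * q)%g by rewrite -conjgC.
have SJ : S (p ^ q)%g = S p.
  by apply: (@addrI _ (S q)); rewrite -SM // E SM // addrC.
have RJ : restrict B (base (p ^ q)%g) =
    (restrict B (base p) ^ restrict B (base q))%g.
  by apply: (@mulgI _ (restrict B (base q))); rewrite -RM // E RM // -conjgC.
by rewrite -/B -/(S (p ^ q)%g) -/(S p) SJ RJ cfunJ ?inE.
Qed.

Definition block_char (la : r.-tuple (seq nat)) : 'CF(block_subgroup la) :=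
  Cfun 0 (block_char_subproof la).

Definition psi (la : r.-tuple (seq nat)) : 'CF(wreath) :=
  ('Ind[wreath] (block_char la))%R.

End Wreath.

(* Main.v *)
Require Import Defs.
From mathcomp Require Import all_boot all_order all_algebra.
From mathcomp Require Import all_fingroup all_solvable all_field all_character.
From mathcomp Require Import zify.

(* Both sides are computed by counting words. The alternant form of Frobenius'
   formula says that the character of the Specht module of la at s is the sum of
   the coefficients of x^(la + delta) in a_(delta + content h), over the words h
   in N >= size la letters that are constant on the cycles of s. It is obtained
   by showing that the Specht character chi and the class function theta given
   by the formula satisfy '[chi] = '[chi, theta] = '[theta] = 1, so that
   '[chi - theta] = 0.

   On the wreath product side, the definition of an induced character turns psi
   into a sum over the words in the letters (j, i), with j < r and i < a, that
   are constant on the cycles of base p; the weight of a word is the product over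
   j of the coefficients attached to la^(j). On the symmetric group side one uses
   r * a letters. Multiplying all cycle lengths by r preserves the residues mod r
   of the exponents, and the beta numbers of phi la of residue j are the r y + j
   for y a beta number of la^(j). Hence, once rows and columns are sorted by
   residues, the determinant that gives the coefficient is block diagonal, with
   blocks the determinants of the la^(j). The sign of the sorting permutation is
   sign_r, and it depends on phi la only. *)

Set Implicit Arguments.
Unset Strict Implicit.
Unset Printing Implicit Defensive.

Import GRing.Theory Num.Theory.
Local Open Scope nat_scope.

(** * Words and the symmetric group *)

(** The formula is used with two coefficients, [altcoef] and [jtcoef], whose sums over the words
    fixed by s agree. They are triangular in opposite directions: the first vanishes unless the
    partial sums of the content are at most those of la, the second unless they are at least those
    of la. This is why ['[theta]] takes one factor of each kind. It is also why ['[chi, theta]] uses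
    [jtcoef]: the Young symmetrizer sees only column distinct fillings, whose contents are bounded
    by la from the other side, so only the content la survives.

    The sign must be a function of the partition [phi la], while the block determinants are formed
    from the components of la. Hence the sorting permutation is defined from the residues of the
    beta numbers of [phi la], and the number of letters per component is fixed as
    [(sumn (phi la)).+1]: computable from [phi la], at least the number of rows of every component,
    and positive, so that a default letter exists. *)

Section Words.
Local Open Scope ring_scope.
Variables (m : nat) (L : finType).
Implicit Types (h k : {ffun 'I_m -> L}) (s t : 'S_m).

Definition content h : {ffun L -> nat} := [ffun l => \sum_x (h x == l)]%N.

(** In [s * t] the permutation s acts first, so precomposition reverses products; this is where the
    inverses in later reindexings come from. *)
Definition word_act h s : {ffun 'I_m -> L} := [ffun x => h (s x)].

Lemma word_act1 h : word_act h 1 = h.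
Proof. by apply/ffunP=> x; rewrite ffunE perm1. Qed.

Lemma word_actM h s t : word_act h (s * t) = word_act (word_act h t) s.
Proof. by apply/ffunP=> x; rewrite !ffunE permM. Qed.

Lemma word_actK s : cancel (word_act^~ s) (word_act^~ s^-1%g).
Proof. by move=> h; rewrite -word_actM mulVg word_act1. Qed.

Lemma word_actKV s : cancel (word_act^~ s^-1%g) (word_act^~ s).
Proof. by move=> h; rewrite -word_actM mulgV word_act1. Qed.

Lemma word_act_bij s : bijective (word_act^~ s).
Proof. by exists (word_act^~ s^-1%g); [apply: word_actK | apply: word_actKV]. Qed.

Lemma content_word_act h s : content (word_act h s) = content h.
Proof.
apply/ffunP=> l; rewrite !ffunE [RHS](reindex_inj (@perm_inj _ s)) /=.
by apply: eq_bigr => x _; rewrite ffunE.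
Qed.

Lemma sum_content h : (\sum_l content h l)%N = m.
Proof.
under eq_bigr do rewrite ffunE; rewrite exchange_big /= -[RHS]card_ord -sum1_card.
apply: eq_bigr => x _; rewrite (bigD1 (h x)) //= eqxx big1 // => l.
by rewrite eq_sym => /negbTE->.
Qed.

Lemma content_le h l : (content h l <= m)%N.
Proof. by rewrite -[leqRHS](sum_content h) (bigD1 l) //= leq_addr. Qed.

Lemma count_codom h l : count_mem l (codom h) = content h l.
Proof.
rewrite ffunE /codom /image_mem count_map -sum1_count big_mkcond /= big_enum /=.
by apply: eq_bigr => x _; case: (h x == l).
Qed.

Lemma content_eq_word_act h k : content h = content k -> exists s, k = word_act h s.
Proof.
move=> E; have : perm_eq [tuple k x | x < m] [tuple h x | x < m].
  have co (f : {ffun 'I_m -> L}) : [tuple f x | x < m] = codom f :> seq L.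
    by rewrite /= /codom /image_mem.
  by apply/allP=> l _ /=; rewrite !co !count_codom E.
case/tuple_permP=> s Es; exists s; apply/ffunP=> x; rewrite ffunE.
have /(congr1 (fun v : m.-tuple L => tnth v x)) : [tuple k x | x < m] =
    [tuple tnth [tuple h x | x < m] (s i) | i < m] by apply: val_inj => /=; exact: Es.
by rewrite !tnth_mktuple.
Qed.

Lemma word_of_content (c : {ffun L -> nat}) :
  (\sum_l c l)%N = m -> exists h, content h = c.
Proof.
move=> sc; pose w := flatten [seq nseq (c l) l | l <- enum L].
have sz : size w == m.
  rewrite size_flatten /shape -map_comp sumnE big_map big_enum /= -[X in _ == X]sc.
  by apply/eqP/eq_bigr=> l _; rewrite /= size_nseq.
exists [ffun x => tnth (Tuple sz) x]; apply/ffunP=> l; rewrite -count_codom.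
rewrite (_ : codom _ = w); last first.
  by rewrite -[RHS](map_tnth_enum (Tuple sz)); apply: eq_codom => x; rewrite ffunE.
rewrite count_flatten -map_comp sumnE big_map big_enum /= (bigD1 l) //=.
rewrite count_nseq /= eqxx mul1n big1 ?addn0 // => i il.
by rewrite count_nseq /= (negbTE il).
Qed.

Lemma card_word_act_transporter h k : content h = content k ->
  #|[set s | word_act h s == k]| = #|[set s | word_act h s == h]|.
Proof.
case/content_eq_word_act=> t ->.
rewrite -(card_imset [set s | word_act h s == h] (mulgI t)).
congr #|pred_of_set _|; apply/setP=> s; rewrite inE; apply/idP/imsetP.
  move/eqP=> E; exists (t^-1 * s)%g; last by rewrite mulgA mulgV mul1g.
  by rewrite inE word_actM E -word_actM mulVg word_act1.
by case=> u; rewrite inE => /eqP E ->; rewrite word_actM E.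
Qed.

(** Burnside counting: the words of a given content form one orbit, so each content accounts for m!
    pairs of a word and a permutation fixing it. Contents are taken with values in ['I_m.+1] in
    order to range over a finite type. *)
Lemma sum_fixed_words (F : {ffun L -> nat} -> algC) :
  \sum_s \sum_(h | word_act h s == h) F (content h) =
    m`!%:R * \sum_(A : {ffun L -> 'I_m.+1} | (\sum_l A l == m)%N)
                F [ffun l => A l : nat].
Proof.
pose nc h : {ffun L -> 'I_m.+1} := [ffun l => inord (content h l)].
have ncE h l : nc h l = content h l :> nat.
  by rewrite [nc h]/nc ffunE inordK // ltnS content_le.
rewrite (exchange_big_dep predT) //=.
under eq_bigr => h _ do rewrite sumr_const.
rewrite (partition_big nc (fun A => \sum_l A l == m)%N) /=; last first.
  by move=> h _; under eq_bigr do rewrite ncE; rewrite sum_content.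
rewrite mulr_sumr; apply: eq_bigr => A /eqP sA.
have [h0 Eh0] := @word_of_content [ffun l => A l : nat]
   (etrans (eq_bigr _ (fun l _ => ffunE _ l)) sA).
have ncA h : (nc h == A) = (content h0 == content h).
  rewrite Eh0; apply/eqP/eqP=> [<-|E].
    by apply/ffunP=> l; rewrite ffunE ncE.
  by apply/ffunP=> l; apply: val_inj; rewrite /= ncE -E ffunE.
(* The stabilizer of h has as many elements as the set of permutations carrying h0 to h, and the
   latter sets partition S_m. *)
transitivity (\sum_(h | content h0 == content h)
                (#|[set s | word_act h0 s == h]|%:R * F (content h0))).
  apply: eq_big => h; first by rewrite ncA.
  rewrite ncA => /eqP E; rewrite mulr_natl E; congr (_ *+ _).
  transitivity #|[set s | word_act h s == h]|; first by rewrite cardsE.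
  rewrite -(card_word_act_transporter (esym E)) -(card_imset _ invg_inj).
  apply: eq_card => s; rewrite [in RHS]inE; apply/imsetP/eqP; last first.
    move=> Es; exists s^-1%g; last by rewrite invgK.
    by rewrite inE -Es word_actK.
  by case=> t; rewrite inE => /eqP Et ->; rewrite -Et word_actK.
rewrite -mulr_suml -natr_sum Eh0; congr (_%:R * _).
rewrite -Eh0 -card_Sn -sum1_card.
rewrite (partition_big (word_act h0) (fun h => content h0 == content h)) /=.
  by apply: eq_bigr => h _; rewrite -sum1_card; apply: eq_bigl => s; rewrite !inE.
by move=> s _; rewrite content_word_act.
Qed.
End Words.

(** * Two expansions of the alternants *)

(* la + delta, where delta = (N-1, ..., 1, 0). *)
Definition beta (N : nat) (la : seq nat) (i : nat) : nat :=
  nth 0 la i + (N - i.+1).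

Lemma sum_nth_sumn (N : nat) (la : seq nat) :
  size la <= N -> \sum_(i < N) nth 0 la i = sumn la.
Proof.
move=> szla; rewrite sumnE (big_nth 0) big_mkord.
rewrite (big_ord_widen _ (fun i => nth 0 la i) szla) [RHS]big_mkcond /=.
by apply: eq_bigr => i _; case: ltnP => // /(nth_default 0)->.
Qed.

Section Dets.
Local Open Scope ring_scope.
Variables (N : nat) (la : seq nat).
Hypothesis la_sorted : sorted geq la.
Implicit Types c : {ffun 'I_N -> nat}.

(* The coefficient of the permutation character on words of content c in the
   Jacobi-Trudi expansion of the irreducible character indexed by la. *)
Definition jtcoef c : algC :=
  \det (\matrix_(i < N, j < N) (c i + (N - j.+1) == beta N la i)%N%:R).

(* The coefficient of x^(la + delta) in the alternant a_(c + delta). *)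
Definition altcoef c : algC :=
  \det (\matrix_(i < N, j < N) (c i + (N - i.+1) == beta N la j)%N%:R).

Lemma nth_part_le i j : (i <= j)%N -> (nth 0%N la j <= nth 0%N la i)%N.
Proof.
move=> ij; have [jla|laj] := ltnP j (size la); last by rewrite nth_default.
have := sorted_leq_nth (leT := geq) _ _ 0%N la_sorted.
apply => //; rewrite ?inE ?(leq_ltn_trans ij) //.
  by move=> a b d /= ba db; apply: leq_trans db ba.
by move=> a /=.
Qed.

Lemma beta_lt (i j : nat) : (i < j)%N -> (j < N)%N -> (beta N la j < beta N la i)%N.
Proof. by move=> ij jN; rewrite /beta; have := nth_part_le (ltnW ij); lia. Qed.

Lemma beta_inj : injective (fun i : 'I_N => beta N la i).
Proof.
move=> i j E; apply: val_inj => /=.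
have := @beta_lt i j; have := @beta_lt j i; have := ltn_ord i; have := ltn_ord j.
lia.
Qed.

Lemma prod_natb (T : finType) (P : pred T) :
  \prod_i ((P i)%:R : algC) = [forall i, P i]%:R.
Proof.
have [/forallP allP|] := boolP [forall i, P i].
  by rewrite big1 // => i _; rewrite allP.
by rewrite negb_forall => /existsP[i Pi]; rewrite (bigD1 i) //= (negbTE Pi) mul0r.
Qed.

Lemma det_natb (P : 'I_N -> 'I_N -> bool) :
  \det (\matrix_(i, j) (P i j)%:R) =
  \sum_(w : 'S_N) (-1) ^+ w * [forall i, P i (w i)]%:R :> algC.
Proof.
apply: eq_bigr => w _; congr (_ * _); rewrite -prod_natb.
by apply: eq_bigr => i _; rewrite mxE.
Qed.

Lemma det_natb_neq0 (P : 'I_N -> 'I_N -> bool) :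
  \det (\matrix_(i, j) (P i j)%:R) != 0 :> algC ->
  exists w : 'S_N, forall i, P i (w i).
Proof.
rewrite det_natb => nz.
have [/existsP[w /forallP Pw]|] := boolP [exists w : 'S_N, [forall i, P i (w i)]].
  by exists w.
rewrite negb_exists => /forallP noP; case/eqP: nz; apply: big1 => w _.
by rewrite (negbTE (noP w)) mulr0.
Qed.

(** Compare with the threshold [f k]: when the first k positions are replaced by their images under
    w, every position gained has value at most [f k] and every position lost has value at least
    [f k]. *)
Lemma sum_perm_antitone (f : nat -> nat) (w : 'S_N) (k : nat) :
  {homo f : i j / (i <= j)%N >-> (j <= i)%N} ->
  (\sum_(i < N | i < k) f (w i) <= \sum_(i < N | i < k) f i)%N.
Proof.
move=> f_anti; rewrite (reindex_inj (@perm_inj _ w^-1)) /=.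
under eq_bigr do rewrite permKV.
have card_eq : (\sum_(i < N | w^-1%g i < k) f k = \sum_(i < N | i < k) f k)%N.
  by rewrite [RHS](reindex_inj (@perm_inj _ w^-1)) /=.
rewrite -(leq_add2r (\sum_(i < N | i < k) f k)%N) -[in leqRHS]card_eq.
rewrite !(big_mkcond (fun i : 'I_N => (_ < k)%N)) -!big_split /=.
apply: leq_sum => i _; case: ltnP => wi; case: ltnP => ik; rewrite ?addn0 ?add0n //.
- exact: f_anti.
- exact/f_anti/ltnW.
Qed.

Lemma sum_lt_ord_recr (f : 'I_N -> nat) (i : 'I_N) :
  (\sum_(j < N | j < i.+1) f j = \sum_(j < N | j < i) f j + f i)%N.
Proof.
rewrite (bigD1 i) //= addnC; congr (_ + _)%N; apply: eq_bigl => j.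
by rewrite ltnS -(inj_eq val_inj) /= ltn_neqAle andbC.
Qed.

Lemma partial_sums_inj (f g : 'I_N -> nat) :
  (forall k, \sum_(j < N | j < k) f j = \sum_(j < N | j < k) g j)%N -> f =1 g.
Proof.
move=> E i; have := E i.+1; rewrite !sum_lt_ord_recr E; exact: addnI.
Qed.

(** [sum_perm_antitone] wants a function antitone on all naturals, whereas [beta_lt] speaks of
    indices below N; truncating the index bridges the two. *)
Lemma beta_anti : (0 < N)%N ->
  {homo (fun i => beta N la (minn i N.-1)) : i j / (i <= j)%N >-> (j <= i)%N}.
Proof.
move=> N0 i j ij /=; have := @beta_lt (minn i N.-1) (minn j N.-1).
have [->|ne] := eqVneq (minn i N.-1) (minn j N.-1); first by rewrite leqnn.
move=> lt; apply: ltnW; apply: lt; lia.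
Qed.

(** A nonzero term of the determinant exhibits c + delta as a rearrangement of the strictly
    decreasing la + delta, whose first k entries have the largest sum. *)
Lemma altcoef_psum c k : altcoef c != 0 ->
  (\sum_(i < N | i < k) c i <= \sum_(i < N | i < k) nth 0%N la i)%N.
Proof.
case/det_natb_neq0=> w /= cw; rewrite -(leq_add2r (\sum_(i < N | i < k) (N - i.+1))%N).
rewrite -!big_split /= (eq_bigr (fun i => beta N la (minn (w i) N.-1))); last first.
  by move=> i _; rewrite (eqP (cw i)); congr (beta N la _); have := ltn_ord (w i); lia.
have [N0|N0] := posnP N.
  by rewrite !big1 // => i; have := ltn_ord i; rewrite {2}N0.
rewrite (leq_trans (sum_perm_antitone w k (beta_anti N0))) //.
apply: leq_sum => i _; rewrite leq_eqVlt; apply/orP; left; apply/eqP.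
by congr (beta N la _); have := ltn_ord i; lia.
Qed.

(** A nonzero term gives c + (delta permuted) = la + delta, and permuting delta can only lower its
    partial sums. *)
Lemma jtcoef_psum c k : jtcoef c != 0 ->
  (\sum_(i < N | i < k) nth 0%N la i <= \sum_(i < N | i < k) c i)%N.
Proof.
case/det_natb_neq0=> w /= cw.
have := @sum_perm_antitone (fun i => (N - i.+1)%N) w k.
rewrite -(leq_add2l (\sum_(i < N | i < k) c i)%N) -big_split /=.
under eq_bigr => i _ do rewrite (eqP (cw i)).
by rewrite /beta big_split /= -[leqRHS]addnC [leqLHS]addnC leq_add2l; apply=> i j; lia.
Qed.

Lemma altcoef_self c : (forall i, c i = nth 0%N la i) -> altcoef c = 1.
Proof.
move=> cE; rewrite /altcoef det_natb (bigD1 1%g) //= odd_perm1 mul1r.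
rewrite (_ : [forall i, _] = true) ?big1 ?addr0 // => [w w1|].
  case: forallP => [cw|]; last by rewrite mulr0.
  case/eqP: w1; apply/permP=> i; apply: beta_inj.
  by rewrite perm1 -(eqP (cw i)) cE.
by apply/forallP=> i; rewrite perm1 cE.
Qed.

Lemma jtcoef_self c : (forall i, c i = nth 0%N la i) -> jtcoef c = 1.
Proof.
move=> cE; rewrite /jtcoef det_natb (bigD1 1%g) //= odd_perm1 mul1r.
rewrite (_ : [forall i, _] = true) ?big1 ?addr0 // => [w w1|].
  case: forallP => [cw|]; last by rewrite mulr0.
  case/eqP: w1; apply/permP=> i; apply: val_inj => /=; rewrite perm1.
  have := cw i; rewrite cE /beta; have := ltn_ord i; have := ltn_ord (w i); lia.
by apply/forallP=> i; rewrite perm1 cE.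
Qed.

Lemma altcoef_tperm c c' (i j : 'I_N) : i != j ->
  (forall k, c' k + (N - k.+1) = c (tperm i j k) + (N - (tperm i j k).+1))%N ->
  altcoef c' = - altcoef c.
Proof.
move=> ij E; rewrite /altcoef; set M := \matrix_(i, j) _; set M' := \matrix_(i, j) _.
have -> : M = row_perm (tperm i j) M' by apply/matrixP=> k l; rewrite !mxE -E.
by rewrite row_permE det_mulmx det_perm odd_tperm ij expr1 mulN1r.
Qed.

(* Relabelling the letters of the words by w turns one expansion into the other. *)
Lemma sum_jtcoef_altcoef m (s : 'S_m) :
  \sum_(h | word_act h s == h) jtcoef (content h) =
  \sum_(h | word_act h s == h) altcoef (content h).
Proof.
rewrite /jtcoef /altcoef.
under eq_bigr do rewrite det_natb; under [RHS]eq_bigr do rewrite det_natb.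
rewrite exchange_big [RHS]exchange_big /= [RHS](reindex_inj invg_inj) /=.
apply: eq_bigr => w _; pose rel (h : {ffun 'I_m -> 'I_N}) := [ffun x => w^-1%g (h x)].
have rel_inj : injective rel.
  by move=> h k /ffunP E; apply/ffunP=> x; have := E x; rewrite !ffunE => /perm_inj.
rewrite (reindex_inj rel_inj) /=; apply: eq_big => h.
  apply/eqP/eqP=> /ffunP E; apply/ffunP=> x; have := E x; rewrite !ffunE.
    by move/perm_inj.
  by move->.
move=> _; rewrite odd_permV; congr (_ * _%:R).
have crel i : content (rel h) i = content h (w i).
  rewrite !ffunE; apply: eq_bigr => x _.
  by rewrite ffunE -(inj_eq (@perm_inj _ w)) permKV.
congr nat_of_bool; apply/forallP/forallP => H i.
  by have := H (w^-1%g i); rewrite crel permKV.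
by have := H (w i); rewrite crel permK.
Qed.

(** * A sign-reversing involution on matrices of natural numbers *)

Section Matrices.
Variable m : nat.
Local Notation mat := {ffun 'I_N * 'I_N -> 'I_m.+1}.
Implicit Types A : mat.

Definition rowsum (A : {ffun 'I_N * 'I_N -> nat}) : {ffun 'I_N -> nat} :=
  [ffun x => \sum_y A (x, y)]%N.
Definition colsum (A : {ffun 'I_N * 'I_N -> nat}) : {ffun 'I_N -> nat} :=
  [ffun y => \sum_x A (x, y)]%N.
Definition nat_mx A : {ffun 'I_N * 'I_N -> nat} := [ffun p => A p : nat].

(** Columns l0 and l are swapped, except that in row i one unit stays in column l; it compensates
    for delta being one larger at l0 than at l when l = l0 + 1. On matrices with a positive entry at
    (i, l) this is an involution. *)
Definition exchange (i l0 l : 'I_N) A (p : 'I_N * 'I_N) : nat :=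
  let: (x, y) := p in
  if x == i then
    if y == l0 then (A (i, l)).-1 else if y == l then (A (i, l0)).+1 else A (x, y)
  else A (x, tperm l0 l y).

Definition exchange_mx i l0 l A : mat := [ffun p => inord (exchange i l0 l A p)].

Lemma exchange_row i l0 l A x : l0 != l -> (0 < A (i, l))%N ->
  (\sum_y exchange i l0 l A (x, y) = \sum_y A (x, y))%N.
Proof.
move=> ll A0; rewrite /exchange; have [->|_] := eqVneq x i; last first.
  by rewrite [RHS](reindex_inj (@perm_inj _ (tperm l0 l))).
have ll' : l != l0 by rewrite eq_sym.
rewrite (bigD1 l0) // (bigD1 l) //= eqxx (negbTE ll') eqxx.
rewrite [RHS](bigD1 l0) // (bigD1 l) //= !addnA; congr (_ + _)%N.
  by rewrite addnS -addSn prednK // addnC.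
by apply: eq_bigr => y /andP[/negbTE-> /negbTE->].
Qed.

Lemma exchange_col i l0 l A y : l0 != l -> (0 < A (i, l))%N ->
  (\sum_x exchange i l0 l A (x, y) + (y == l0) =
   \sum_x A (x, tperm l0 l y) + (y == l))%N.
Proof.
move=> ll A0; rewrite (bigD1 i) // [in RHS](bigD1 i) //= eqxx.
rewrite (eq_bigr (fun x => nat_of_ord (A (x, tperm l0 l y)))); last first.
  by move=> x /negbTE->.
case: tpermP => [->|->|/eqP/negbTE-> /eqP/negbTE-> //].
  by rewrite eqxx (negbTE ll) addnAC addn1 prednK // addn0.
by rewrite eqxx eq_sym (negbTE ll) addn0 addSn addn1.
Qed.

Lemma sum_pairE (f : 'I_N * 'I_N -> nat) :
  (\sum_p f p = \sum_x \sum_y f (x, y))%N.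
Proof. by rewrite pair_bigA; apply: eq_bigr => -[]. Qed.

Lemma exchange_bound i l0 l A p : l0 != l -> (0 < A (i, l))%N ->
  (\sum_p A p == m)%N -> (exchange i l0 l A p < m.+1)%N.
Proof.
move=> ll A0 /eqP sA; rewrite ltnS -[leqRHS]sA.
have -> : (\sum_p A p = \sum_x \sum_y exchange i l0 l A (x, y))%N.
  under [RHS]eq_bigr => x _ do rewrite (exchange_row x ll A0).
  by rewrite pair_bigA; apply: eq_bigr => -[].
by rewrite pair_bigA (bigD1 p) //=; case: p => x y /=; exact: leq_addr.
Qed.

(** The order in which entries above the diagonal are shown to vanish: rows from top to bottom, each
    row from right to left. With this order an exchange at (i, l) does not disturb the zeros already
    obtained. *)
Definition elim_code (x y : nat) := (x * N + (N - y.+1))%N.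

Lemma elim_code_lt (x y x' y' : nat) :
  (x < x')%N -> (y < N)%N -> (elim_code x y < elim_code x' y')%N.
Proof.
move=> xx yN; have := leq_mul xx (leqnn N); rewrite /elim_code mulSn; lia.
Qed.

Definition lower_upto k A := (\sum_p A p == m)%N &&
  [forall x : 'I_N, forall y : 'I_N,
     ((x < y) && (elim_code x y < k))%N ==> (A (x, y) == 0%N :> nat)].

(* Exchanging the columns l0 and l = l0 + 1 of A, and shifting one unit inside
   row i, swaps two entries of [colsum A + delta] and keeps the row sums. *)
Lemma elim_step (F : {ffun 'I_N -> nat} -> algC) k (i l0 l : 'I_N) :
  (i < l)%N -> l0.+1 = l -> elim_code i l = k ->
  \sum_(A | lower_upto k A && (0 < A (i, l))%N)
     F (rowsum (nat_mx A)) * altcoef (colsum (nat_mx A)) = 0.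
Proof.
move=> il ll kE.
have l0l : l0 != l by rewrite -(inj_eq val_inj) /=; lia.
have exchangeE A : lower_upto k A && (0 < A (i, l))%N ->
    forall p, exchange_mx i l0 l A p = exchange i l0 l A p :> nat.
  case/andP=> /andP[sA _] A0 p; rewrite ffunE inordK //.
  exact: exchange_bound.
have exchange_in A : lower_upto k A && (0 < A (i, l))%N ->
    lower_upto k (exchange_mx i l0 l A) && (0 < exchange_mx i l0 l A (i, l))%N.
  move=> HA; have EA := exchangeE A HA; case/andP: HA => /andP[sA /forallP lA] A0.
  have lA0 (x y : 'I_N) : (x < y)%N -> (elim_code x y < k)%N -> A (x, y) = 0%N :> nat.
    by move=> xy xyk; apply/eqP; have /forallP/(_ y) := lA x; rewrite xy xyk.
  rewrite EA /= eqxx eq_sym (negbTE l0l) eqxx andbT; apply/andP; split.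
    rewrite -[X in _ == X](eqP sA); apply/eqP.
    rewrite !sum_pairE.
    apply: eq_bigr => x _; rewrite -(exchange_row x l0l A0).
    by apply: eq_bigr => y _; rewrite EA.
  apply/forallP=> x; apply/forallP=> y; apply/implyP=> /andP[xy xyk].
  rewrite EA /=; have := ltn_ord x; have := ltn_ord y; have := ltn_ord l.
  move=> lN yN xN.
  have [xi|/eqP xi] := eqVneq x i.
    have ly : (l < y)%N by move: xyk; rewrite -kE xi /elim_code; lia.
    have -> : (y == l0) = false by apply/eqP=> E; move: ly; rewrite E; lia.
    have -> : (y == l) = false by apply/eqP=> E; move: ly; rewrite E; lia.
    by rewrite lA0.
  have xi' : (x < i)%N.
    have xi' : x <> i :> nat by move=> /val_inj.
    by have := @elim_code_lt i l x y; move: xyk; rewrite -kE; lia.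
  (* Row x lies above row i, and i <= l0 < l, so both swapped entries are above the diagonal and
     already zero. *)
  case: tpermP => [_|_|_ _]; rewrite lA0 // -?kE ?elim_code_lt //; lia.
have exchangeK A : lower_upto k A && (0 < A (i, l))%N ->
    exchange_mx i l0 l (exchange_mx i l0 l A) = A.
  move=> HA; apply/ffunP=> -[x y]; apply: val_inj => /=.
  have l0l' : (l == l0) = false by rewrite eq_sym (negbTE l0l).
  rewrite exchangeE ?exchange_in //= !exchangeE //= !eqxx l0l'.
  have [->|_] := eqVneq x i; last by rewrite tpermK.
  case: eqP => [->|_] //=; case: eqP => [->|//].
  by case/andP: HA => _ A0; rewrite prednK.
set S := LHS; have : S = - S.
  rewrite {1}/S (reindex_onto (exchange_mx i l0 l) (exchange_mx i l0 l)) //=.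
  rewrite -sumrN; apply: eq_big => A.
    apply/andP/idP => [[HA /eqP <-]|HA]; first exact: exchange_in.
    by rewrite exchange_in ?exchangeK.
  case/andP=> HA' /eqP HA.
  have {}HA : lower_upto k A && (0 < A (i, l))%N by rewrite -HA exchange_in.
  have A0 := proj2 (andP HA).
  rewrite -mulrN; congr (F _ * _).
    apply/ffunP=> x; rewrite !ffunE; under [RHS]eq_bigr do rewrite ffunE.
    rewrite -(exchange_row x l0l A0).
    by apply: eq_bigr => y _; rewrite ffunE exchangeE.
  apply: (altcoef_tperm l0l) => y; rewrite !ffunE.
  under eq_bigr do rewrite ffunE exchangeE //; under [in RHS]eq_bigr do rewrite ffunE.
  have := exchange_col y l0l A0; set a := (\sum_x exchange _ _ _ _ _)%N.
  set b := (\sum_x A _)%N; move: a b => a b; have := ltn_ord l; rewrite -ll.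
  case: tpermP => [->|->|ne ne'].
  - by rewrite eqxx (negbTE l0l) -ll; lia.
  - by rewrite eqxx eq_sym (negbTE l0l) -ll; lia.
  - by move/eqP/negbTE: ne => ->; move/eqP/negbTE: ne' => ->; lia.
by move/eqP; rewrite -addr_eq0 -mulr2n mulrn_eq0 /= => /eqP.
Qed.

(** Induction on k: if k is the code of a position above the diagonal, the matrices with a positive
    entry there cancel by [elim_step]; otherwise the condition does not change. *)
Lemma elim_upper (F : {ffun 'I_N -> nat} -> algC) k :
  \sum_(A : mat | (\sum_p A p == m)%N)
     F (rowsum (nat_mx A)) * altcoef (colsum (nat_mx A)) =
  \sum_(A | lower_upto k A) F (rowsum (nat_mx A)) * altcoef (colsum (nat_mx A)).
Proof.
elim: k => [|k ->].
  apply: eq_bigl => A; rewrite /lower_upto andbC.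
  by case: forallP => // -[] x; apply/forallP=> y; rewrite ltn0 andbF.
have [N0|N0] := posnP N.
  apply: eq_bigl => A; rewrite /lower_upto; congr (_ && _).
  by apply/forallP/forallP => _ x; have := ltn_ord x; rewrite {2}N0.
have codeE (x y : 'I_N) : elim_code x y = k -> (x = (k %/ N)%N :> nat) /\ (N - y.+1 = k %% N)%N.
  move=> <-; rewrite /elim_code divnMDl // modnMDl divn_small ?modn_small //; lia.
pose P (x y : 'I_N) := (x < y)%N && (elim_code x y == k).
have [/existsP[i /existsP[l /andP[il /eqP kE]]]|noP] :=
    boolP [exists i, [exists l, P i l]].
  have l0P : (l.-1 < N)%N by have := ltn_ord l; lia.
  have ll : (Ordinal l0P).+1 = l by rewrite /=; lia.
  rewrite (bigID (fun A : mat => (0 < A (i, l))%N)) /= (elim_step F il ll kE) add0r.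
  apply: eq_bigl => A; rewrite -leqNgt leqn0 /lower_upto -andbA; congr (_ && _).
  apply/andP/forallP => [[/forallP lA /eqP A0] x | lA].
    apply/forallP=> y; apply/implyP=> /andP[xy]; rewrite ltnS leq_eqVlt.
    case/orP => [/eqP xyk|xyk]; last first.
      by have /forallP/(_ y) := lA x; rewrite xy xyk.
    have [] := codeE _ _ xyk; have [] := codeE _ _ kE => <- <- xi yl.
    have -> : x = i by apply: val_inj.
    have -> : y = l by apply: val_inj => /=; have := ltn_ord y; have := ltn_ord l; lia.
    by rewrite A0.
  split; last by have /forallP/(_ l) := lA i; rewrite il kE ltnSn.
  apply/forallP=> x; apply/forallP=> y; apply/implyP=> /andP[xy xyk].
  by have /forallP/(_ y) := lA x; rewrite xy ltnW.
apply: eq_bigl => A; rewrite /lower_upto; congr (_ && _).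
apply/forallP/forallP => lA x; apply/forallP=> y; apply/implyP=> /andP[xy xyk];
  have /forallP/(_ y) := lA x; rewrite xy /=; last by rewrite ltnW.
move: xyk; rewrite ltnS leq_eqVlt => /orP[xyk|-> //].
by case/negP: noP; apply/existsP; exists x; apply/existsP; exists y; rewrite /P xy.
Qed.

(* By [elim_upper] only lower triangular matrices contribute, so the partial sums
   of the rows are at most those of the columns; a nonzero term bounds the former
   from below and the latter from above by those of la. *)
Lemma sum_jt_alt : (size la <= N)%N -> sumn la = m ->
  \sum_(A : mat | (\sum_p A p == m)%N)
     jtcoef (rowsum (nat_mx A)) * altcoef (colsum (nat_mx A)) = 1.
Proof.
move=> szla sla; rewrite (elim_upper jtcoef (N * N)).
have sum_la : (\sum_(i < N) nth 0%N la i = m)%N by rewrite sum_nth_sumn.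
have nth_lt (i : 'I_N) : (nth 0%N la i < m.+1)%N.
  by rewrite ltnS -sum_la (bigD1 i) //= leq_addr.
pose D : mat := [ffun p : 'I_N * 'I_N => inord (if p.1 == p.2 then nth 0%N la p.1 else 0%N)].
have DE (x y : 'I_N) : D (x, y) = (if x == y then nth 0%N la x else 0%N) :> nat.
  by rewrite ffunE inordK //=; case: eqP.
have Drow x : (\sum_y D (x, y) = nth 0%N la x)%N.
  rewrite (bigD1 x) //= DE eqxx big1 ?addn0 // => y.
  by rewrite DE eq_sym => /negbTE->.
have Dcol y : (\sum_x D (x, y) = nth 0%N la y)%N.
  rewrite (bigD1 y) //= DE eqxx big1 ?addn0 // => x.
  by rewrite DE => /negbTE->.
have natD (f : mat) : (rowsum (nat_mx f) = [ffun x => \sum_y f (x, y)]%N) *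
   (colsum (nat_mx f) = [ffun y => \sum_x f (x, y)]%N).
  by split; apply/ffunP=> x; rewrite !ffunE; apply: eq_bigr => y _; rewrite ffunE.
have D_lower : lower_upto (N * N) D.
  apply/andP; split; first by rewrite sum_pairE; under eq_bigr do rewrite Drow; apply/eqP.
  apply/forallP=> x; apply/forallP=> y; apply/implyP=> /andP[xy _].
  by rewrite DE; have [xy'|//] := eqVneq x y; move: xy; rewrite xy' ltnn.
rewrite (bigD1 D) //= jtcoef_self ?altcoef_self ?mulr1 => [|i|i]; last first.
- by rewrite natD ffunE Drow.
- by rewrite natD ffunE Dcol.
rewrite big1 ?addr0 // => A /andP[/andP[/eqP sA /forallP lA] AD].
have {}lA (x y : 'I_N) : (x < y)%N -> A (x, y) = 0%N :> nat.
  move=> xy; apply/eqP; have /forallP/(_ y) := lA x; rewrite xy => /implyP; apply.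
  rewrite /elim_code; have := ltn_ord x; have := ltn_ord y => yN xN.
  by have := leq_mul xN (leqnn N); rewrite mulSn; lia.
apply/eqP; rewrite mulf_eq0; apply/negPn/negP; rewrite negb_or => /andP[jt0 alt0].
case/negP: AD; apply/eqP.
pose R k := (\sum_(x < N | x < k) \sum_(y < N) A (x, y))%N.
pose C k := (\sum_(y < N | y < k) \sum_(x < N) A (x, y))%N.
pose T k := (\sum_(i < N | i < k) nth 0%N la i)%N.
have TR k : (T k <= R k)%N.
  by have := jtcoef_psum k jt0; rewrite natD; under [leqRHS]eq_bigr do rewrite ffunE.
have CT k : (C k <= T k)%N.
  by have := altcoef_psum k alt0; rewrite natD; under [leqLHS]eq_bigr do rewrite ffunE.
have RE k : R k = (\sum_(y < N | y < k) \sum_(x < N | x < k) A (x, y))%N.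
  rewrite /R exchange_big /= [RHS]big_mkcond /=; apply: eq_bigr => y _.
  case: ltnP => // ky; apply: big1 => x xk; apply: lA; lia.
have CE k : C k = (R k + \sum_(y < N | y < k) \sum_(x < N | ~~ (x < k)) A (x, y))%N.
  rewrite RE -big_split /=; apply: eq_bigr => y _.
  by rewrite [LHS](bigID (fun x : 'I_N => (x < k)%N)).
(* T <= R <= C <= T forces equality everywhere. By [CE], C - R is the sum of the entries in the
   first k columns that lie outside the first k rows, so the entries below the diagonal vanish as
   well. *)
have RT k : R k = T k by have := TR k; have := CT k; have := CE k; lia.
have off (x y : 'I_N) : (y < x)%N -> A (x, y) = 0%N :> nat.
  move=> yx; have := CE x; have := TR x; have := CT x => ct tr ce.
  have /eqP : (\sum_(y < N | y < x) \sum_(x' < N | ~~ (x' < x)) A (x', y) = 0)%N.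
    by move: ct tr ce; lia.
  rewrite sum_nat_eq0 => /forallP/(_ y); rewrite yx /= sum_nat_eq0.
  by move=> /forallP/(_ x); rewrite ltnn /= => /eqP.
have diag (x : 'I_N) : (\sum_y A (x, y) = A (x, x))%N.
  rewrite (bigD1 x) //= big1 ?addn0 // => y; rewrite -(inj_eq val_inj) /=.
  by rewrite neq_ltn => /orP[/off|/lA].
have dE := partial_sums_inj RT.
apply/ffunP=> -[x y]; apply: val_inj; rewrite /= DE.
have [<-|] := eqVneq x y; first by rewrite -dE diag.
by rewrite -(inj_eq val_inj) neq_ltn => /orP[/lA|/off].
Qed.

End Matrices.
End Dets.

(** * Tableaux *)

Section Tableau.
Variables (m N : nat) (la : seq nat).
Hypotheses (la_sorted : sorted geq la) (sum_la : sumn la = m) (szla : size la <= N).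
Implicit Types (x y : 'I_m) (h : {ffun 'I_m -> 'I_N}) (s t g p q : 'S_m).

Local Notation rowc x := (reshape_index la x).
Local Notation colc x := (reshape_offset la x).
Local Notation R := (row_stab m la).
Local Notation C := (col_stab m la).

Lemma cell_ltn x : colc x < nth 0 la (rowc x).
Proof. by apply: reshape_offsetP; rewrite sum_la. Qed.

Lemma row_ltn x : rowc x < N.
Proof. by rewrite (leq_trans _ szla) // reshape_indexP // sum_la. Qed.

Lemma cell_inj x y : rowc x = rowc y -> colc x = colc y -> x = y.
Proof.
by move=> r c; apply: val_inj; rewrite /= -(reshape_indexK la x) r c reshape_indexK.
Qed.

Lemma cell_exists (i j : nat) : j < nth 0 la i -> exists x : 'I_m, rowc x = i /\ colc x = j.
Proof.
move=> ji; have lt : flatten_index la i j < m by rewrite -sum_la flatten_indexP.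
by exists (Ordinal lt); rewrite /= flatten_indexKl ?flatten_indexKr.
Qed.

(** Words in ['I_N] are viewed as fillings of the diagram. This one puts in each cell its row
    number; its content is la and its stabilizer is the row stabilizer. *)
Definition rowword : {ffun 'I_m -> 'I_N} := [ffun x => Ordinal (row_ltn x)].

Definition col_distinct h := [forall x : 'I_m, forall y : 'I_m,
  ((colc x == colc y) && (h x == h y)) ==> (x == y)].

Lemma col_distinctP h : reflect (forall x y : 'I_m, colc x = colc y -> h x = h y -> x = y)
  (col_distinct h).
Proof.
apply: (iffP forallP) => [H x y c r|H x].
  by have /forallP/(_ y) := H x; rewrite c r !eqxx => /eqP.
by apply/forallP=> y; apply/implyP=> /andP[/eqP c /eqP r]; apply/eqP/H.
Qed.

Lemma row_stabP p : reflect (word_act rowword p = rowword) (p \in R).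
Proof.
rewrite inE; apply: (iffP forallP) => [H|/ffunP H x].
  by apply/ffunP=> x; rewrite !ffunE; apply: val_inj => /=; apply/eqP.
by have := H x; rewrite !ffunE => /(congr1 val) /= ->.
Qed.

Lemma col_stabP q : reflect (forall x : 'I_m, colc (q x) = colc x) (q \in C).
Proof. by rewrite inE; apply: (iffP forallP) => H x; apply/eqP. Qed.

Lemma row_stab_group_set : group_set R.
Proof.
apply/group_setP; split=> [|p q]; rewrite !inE.
  by apply/forallP=> x; rewrite perm1.
by move=> /forallP Hp /forallP Hq; apply/forallP=> x; rewrite permM (eqP (Hq _)).
Qed.
Canonical row_stab_group := Group row_stab_group_set.

Lemma col_stab_group_set : group_set C.
Proof.
apply/group_setP; split=> [|p q /col_stabP Hp /col_stabP Hq]; apply/col_stabP=> x.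
  by rewrite perm1.
by rewrite permM Hq.
Qed.
Canonical col_stab_group := Group col_stab_group_set.

Lemma row_col_stab1 g : g \in R -> g \in C -> g = 1%g.
Proof.
rewrite inE => /forallP gR /col_stabP gC; apply/permP=> x; rewrite perm1.
by apply: cell_inj => //; apply/eqP.
Qed.

Lemma col_distinct_tperm h : ~~ col_distinct h ->
  exists x y : 'I_m, [/\ x != y, tperm x y \in C & h x = h y].
Proof.
rewrite negb_forall => /existsP[x]; rewrite negb_forall => /existsP[y].
rewrite negb_imply => /andP[/andP[/eqP c /eqP r] xy].
exists x, y; split=> //; apply/col_stabP=> z.
by case: tpermP => // ->.
Qed.

(** If column j has a cell in row k or below, distinctness lets each cell with letter i < k be sent
    injectively to the cell of column j in row i. Otherwise all cells of the column are counted on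
    the right. *)
Lemma card_col_lt h k j : col_distinct h ->
  #|[set x : 'I_m | (colc x == j) && (h x < k)]| <=
  #|[set x : 'I_m | (colc x == j) && (rowc x < k)]|.
Proof.
move/col_distinctP=> hC.
have [/existsP[x0 /andP[/eqP cx0 kx0]]|noC] :=
    boolP [exists x : 'I_m, (colc x == j) && (k <= rowc x)]; last first.
  apply: subset_leq_card; apply/subsetP=> x; rewrite !inE => /andP[cx _].
  rewrite cx /= ltnNge; apply/negP=> kx; case/existsP: noC; exists x.
  by rewrite cx.
have x0P : 0 < m by apply: leq_ltn_trans (ltn_ord x0).
pose f (x : 'I_m) := odflt x0 [pick y : 'I_m | (rowc y == h x) && (colc y == j)].
have fE (x : 'I_m) : h x < k -> rowc (f x) = h x /\ colc (f x) = j.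
  move=> hk; rewrite /f; case: pickP => [y /andP[/eqP-> /eqP->] //|none].
  have [|y [ry cy]] := @cell_exists (h x) j.
    rewrite -cx0 (leq_trans (cell_ltn x0)) // (nth_part_le la_sorted) //.
    by rewrite ltnW // (leq_trans hk).
  by have := none y; rewrite ry cy !eqxx.
rewrite -(card_in_imset (f := f) (D := [set x : 'I_m | (colc x == j) && (h x < k)])).
  apply: subset_leq_card; apply/subsetP=> y /imsetP[x]; rewrite inE.
  by case/andP=> _ hk ->; have [r c] := fE x hk; rewrite inE r c eqxx.
move=> x y; rewrite !inE => /andP[/eqP cx hx] /andP[/eqP cy hy] E.
apply: hC; first by rewrite cx.
by apply: val_inj => /=; have [<- _] := fE x hx; have [<- _] := fE y hy; rewrite E.
Qed.

Lemma nth_le_sumn (l : seq nat) i : nth 0 l i <= sumn l.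
Proof.
elim: l i => [|a l IH] [|i] //=; first by rewrite leq_addr.
by rewrite (leq_trans (IH i)) ?leq_addl.
Qed.

Lemma colc_lt x : colc x < m.
Proof. by rewrite (leq_trans (cell_ltn x)) // (leq_trans (nth_le_sumn _ _)) ?sum_la. Qed.

Lemma sum_content_lt h k :
  \sum_(i < N | i < k) content h i =
  \sum_(j < m) #|[set x : 'I_m | (colc x == j) && (h x < k)]|.
Proof.
transitivity #|[set x : 'I_m | h x < k]|.
  rewrite -sum1_card; under [LHS]eq_bigr do rewrite /content ffunE.
  rewrite exchange_big /= [RHS]big_mkcond /=; apply: eq_bigr => x _.
  rewrite inE big_mkcond (bigD1 (h x)) //= eqxx big1 ?addn0 => [|i].
    by case: ltnP.
  by rewrite eq_sym => /negbTE->; case: ifP.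
rewrite -sum1_card (partition_big (fun x : 'I_m => Ordinal (colc_lt x)) predT) //=.
apply: eq_bigr => j _; rewrite -sum1_card; apply: eq_bigl => x.
by rewrite !inE -(inj_eq val_inj) andbC.
Qed.

Lemma content_rowword i : content rowword i = nth 0 la i.
Proof.
have [la_i|i_la] := ltnP i (size la); last first.
  rewrite nth_default // ffunE; apply: big1 => x _; apply/eqP.
  rewrite eqb0 ffunE -(inj_eq val_inj) /=; apply/eqP=> E.
  have := reshape_indexP (sh := la) (i := x).
  by rewrite sum_la E => /(_ (ltn_ord x)); rewrite ltnNge i_la.
pose f (j : 'I_(nth 0 la i)) : 'I_m := cast_ord sum_la (Ordinal (flatten_indexP (ltn_ord j))).
have f_inj : injective f.
  move=> j k /(congr1 val) /= E; apply: val_inj => /=.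
  by rewrite -[val j](flatten_indexKr (ltn_ord j)) E flatten_indexKr.
rewrite -[RHS](card_ord) -cardsT -(card_imset _ f_inj) ffunE -sum1_card [RHS]big_mkcond /=.
apply: eq_bigr => x _; rewrite ffunE -(inj_eq val_inj) /=.
suff -> : (x \in f @: [set: 'I_(nth 0 la i)]) = (rowc x == i) by case: eqP.
apply/imsetP/eqP => [[j _ ->]|xi]; first by rewrite /= flatten_indexKl.
have cx := cell_ltn x; rewrite xi in cx; exists (Ordinal cx); rewrite ?inE //.
by apply: val_inj; rewrite /= -xi reshape_indexK.
Qed.

Lemma card_col_lt_rowword k j :
  #|[set x : 'I_m | (colc x == j) && (rowword x < k)]| =
  #|[set x : 'I_m | (colc x == j) && (rowc x < k)]|.
Proof. by apply: eq_card => x; rewrite !inE ffunE. Qed.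

Lemma col_distinct_psum h k : col_distinct h ->
  \sum_(i < N | i < k) content h i <= \sum_(i < N | i < k) nth 0 la i.
Proof.
move=> hC; under [leqRHS]eq_bigr do rewrite -content_rowword.
rewrite !sum_content_lt; apply: leq_sum => j _.
by rewrite card_col_lt_rowword card_col_lt.
Qed.

(** Equality of the partial sums forces equality in [card_col_lt] for every column and every k. Each
    column then contains only its own row numbers, each once, so h comes from [rowword] by permuting
    within columns. *)
Lemma col_distinct_rowwordE h : col_distinct h ->
  (forall i, content h i = nth 0 la i) -> exists2 q, q \in C & h = word_act rowword q.
Proof.
move=> hC hE; have card_eq k j : (j < m) ->
    #|[set x : 'I_m | (colc x == j) && (h x < k)]| =
    #|[set x : 'I_m | (colc x == j) && (rowc x < k)]|.
  move=> jm; apply/eqP; rewrite eqn_leq card_col_lt //= leqNgt; apply/negP=> lt.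
  have le : \sum_(i < m | i != Ordinal jm) #|[set x : 'I_m | (colc x == i) && (h x < k)]|
    <= \sum_(i < m | i != Ordinal jm) #|[set x : 'I_m | (colc x == i) && (rowword x < k)]|.
    by apply: leq_sum => i _; rewrite card_col_lt_rowword card_col_lt.
  have := sum_content_lt h k; under eq_bigr do rewrite hE -content_rowword.
  rewrite sum_content_lt (bigD1 (Ordinal jm)) // [in RHS](bigD1 (Ordinal jm)) //=.
  rewrite card_col_lt_rowword => E.
  by have := leq_add lt le; rewrite addSn E ltnn.
have cellP x : exists y : 'I_m, rowc y = h x /\ colc y = colc x.
  apply: cell_exists.
  have [x1 /eqP cx1 max1] := @arg_maxnP _ x (fun y : 'I_m => colc y == colc x)
     (fun y : 'I_m => rowc y) (eqxx _).
  (* With k one more than the last row of the column, the equality says that no letter exceeds that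
     row, so the cell in row [h x] of this column exists. *)
  have sub : [set y : 'I_m | (colc y == colc x) && (h y < (rowc x1).+1)]
     = [set y : 'I_m | colc y == colc x].
    apply/eqP; rewrite eqEcard; apply/andP; split.
      by apply/subsetP=> y; rewrite !inE => /andP[].
    rewrite card_eq ?colc_lt //; apply: subset_leq_card; apply/subsetP=> y.
    by rewrite !inE => cy; rewrite cy ltnS; apply: max1.
  have : x \in [set y : 'I_m | colc y == colc x] by rewrite inE.
  rewrite -sub inE eqxx /= ltnS => hx.
  by rewrite -cx1 (leq_trans (cell_ltn x1)) // nth_part_le.
pose f (x : 'I_m) : 'I_m := odflt x [pick y : 'I_m | (rowc y == h x) && (colc y == colc x)].
have fE (x : 'I_m) : rowc (f x) = h x /\ colc (f x) = colc x.
  rewrite /f; case: pickP => [y /andP[/eqP-> /eqP->] //|none].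
  by have [y [ry cy]] := cellP x; have := none y; rewrite ry cy !eqxx.
have f_inj : injective f.
  move=> x y E; have [rx cx] := fE x; have [ry cy] := fE y.
  apply: (elimT (col_distinctP h) hC); first by rewrite -cx -cy E.
  by apply: val_inj => /=; rewrite -rx -ry E.
exists (perm f_inj); first by apply/col_stabP=> x; rewrite permE; case: (fE x).
by apply/ffunP=> x; rewrite !ffunE; apply: val_inj; rewrite /= permE; case: (fE x).
Qed.

Lemma tperm_row_stab x y : rowword x = rowword y -> tperm x y \in R.
Proof.
move=> E; apply/row_stabP/ffunP=> z; rewrite !ffunE.
by case: tpermP => [->|->|//]; move: E; rewrite !ffunE.
Qed.

(* Either the word of g is column distinct, and g factors, or g carries a
   transposition of the column stabilizer to one of the row stabilizer. *)
Lemma row_col_dichotomy g :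
  (exists p q, [/\ p \in R, q \in C & g = p * q]%g) \/
  (exists t t', [/\ t \in R, t' \in C, odd_perm t' & t * g = g * t']%g).
Proof.
have [hC|/col_distinct_tperm[x [y [xy tC E]]]] :=
  boolP (col_distinct (word_act rowword g^-1)).
  left; have [i|q qC E] := col_distinct_rowwordE hC.
    by rewrite content_word_act content_rowword.
  exists (g * q)%g, q^-1%g; rewrite groupV qC mulgK; split=> //.
  rewrite -groupV invMg; apply/row_stabP.
  by rewrite word_actM E -word_actM mulVg word_act1.
right; exists (tperm (g^-1 x) (g^-1 y))%g, (tperm x y); split=> //.
- by apply: tperm_row_stab; move: E; rewrite !ffunE.
- by rewrite odd_tperm.
by rewrite -tpermJ /conjg invgK !mulgA mulgKV.
Qed.

End Tableau.

(** * The Young symmetrizer *)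

Section Young.
Local Open Scope ring_scope.
Variables (m : nat) (la : seq nat).
Hypotheses (la_sorted : sorted geq la) (sum_la : sumn la = m).
Implicit Types (s t g p q x y z : 'S_m).

Local Notation R := (row_stab m la).
Local Notation C := (col_stab m la).

(** The symmetrizer as a function on the group: its coefficient at g, see [young_symmE]. *)
Definition young_coef g : algC := \sum_(p in R) \sum_(q in C) (-1) ^+ q * (p * q == g)%g%:R.

Lemma young_coef_rowM p g : p \in R -> young_coef (p * g)%g = young_coef g.
Proof.
move=> pR; rewrite /young_coef (reindex_inj (mulgI p)) /=; apply: eq_big => p'.
  by rewrite groupMl.
by move=> _; apply: eq_bigr => q _; rewrite -mulgA (inj_eq (mulgI p)).
Qed.

Lemma young_coef_Mcol g q : q \in C -> young_coef (g * q)%g = (-1) ^+ q * young_coef g.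
Proof.
move=> qC; rewrite /young_coef mulr_sumr; apply: eq_bigr => p _.
rewrite (reindex_inj (mulIg q)) /= mulr_sumr; apply: eq_big => q'.
  by rewrite groupMr.
move=> _; rewrite mulgA (inj_eq (mulIg q)) odd_permM signr_addb mulrA; congr (_ * _).
by rewrite mulrC.
Qed.

Lemma young_coef1 : young_coef 1 = 1.
Proof.
rewrite /young_coef (bigD1 1%g) ?group1 //= (bigD1 1%g) ?group1 //= mulg1 eqxx odd_perm1 mul1r.
rewrite !big1 ?addr0 // => [p /andP[pR p1]|q /andP[_ /negbTE q1]].
  apply: big1 => q qC; case: eqP => [E|]; last by rewrite mulr0.
  case/eqP: p1; apply: (@row_col_stab1 _ la) => //.
  by rewrite (_ : p = q^-1)%g ?groupV //; apply/eqP; rewrite eq_mulgV1 invgK E.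
by rewrite mul1g q1 mulr0.
Qed.

(* This is the classical statement that a x b is a multiple of a b. *)
Lemma young_coef_biequivariant (F : 'S_m -> algC) :
  (forall p g, p \in R -> F (p * g)%g = F g) ->
  (forall g q, q \in C -> F (g * q)%g = (-1) ^+ q * F g) ->
  forall g, F g = F 1%g * young_coef g.
Proof.
move=> FR FC g.
have anti (F' : 'S_m -> algC) t t' : (forall p g, p \in R -> F' (p * g)%g = F' g) ->
    (forall g q, q \in C -> F' (g * q)%g = (-1) ^+ q * F' g) ->
    t \in R -> t' \in C -> odd_perm t' -> (t * g = g * t')%g -> F' g = 0.
  move=> HR HC tR tC od E; have : F' g = - F' g.
    by rewrite -[LHS](HR t) // E HC // od mulN1r.
  by move/eqP; rewrite -addr_eq0 -mulr2n mulrn_eq0 /= => /eqP.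
have [[p [q [pR qC ->]]]|[t [t' [tR tC od E]]]] :=
    row_col_dichotomy la_sorted sum_la (leqnn _) g.
  have Fq : F q = (-1) ^+ q * F 1%g by rewrite -FC ?mul1g.
  have cq : young_coef q = (-1) ^+ q by have := young_coef_Mcol 1 qC; rewrite mul1g young_coef1 mulr1.
  by rewrite FR // young_coef_rowM // Fq cq mulrC.
rewrite (anti F _ _ FR FC tR tC od E).
by rewrite (anti young_coef _ _ young_coef_rowM young_coef_Mcol tR tC od E) mulr0.
Qed.

(** The coefficient at 1 of the square of the symmetrizer, hence the factor by which that square is
    a multiple of the symmetrizer. *)
Definition young_scalar : algC := \sum_y young_coef y * young_coef y^-1%g.

Lemma young_coef_conv x :
  \sum_y young_coef y * young_coef (y^-1 * x)%g = young_scalar * young_coef x.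
Proof.
pose F x := \sum_y young_coef y * young_coef (y^-1 * x)%g.
rewrite -[LHS]/(F x) (@young_coef_biequivariant F) => [|p g pR|g q qC].
- by congr (_ * _); apply: eq_bigr => y _; rewrite mulg1.
- rewrite /F (reindex_inj (mulgI p)) /=; apply: eq_bigr => y _.
  by rewrite young_coef_rowM // invMg -mulgA mulKg.
rewrite /F mulr_sumr; apply: eq_bigr => y _.
by rewrite mulgA young_coef_Mcol // mulrCA.
Qed.

(** As a function of x the sum is invariant under the row stabilizer on the left and alternating
    under the column stabilizer on the right, hence a multiple of [young_coef]; its value at 1 is
    again a convolution. *)
Lemma young_coef_sandwich z x :
  \sum_y young_coef y * young_coef (z * y^-1 * x)%g = young_scalar * young_coef z * young_coef x.
Proof.
pose F x := \sum_y young_coef y * young_coef (z * y^-1 * x)%g.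
rewrite -[LHS]/(F x) (@young_coef_biequivariant F) => [|p g pR|g q qC].
- congr (_ * _); rewrite -young_coef_conv /F.
  rewrite (reindex_inj (inj_comp (mulIg z) invg_inj)) /=; apply: eq_bigr => y _.
  by rewrite mulg1 invMg invgK mulKVg mulrC.
- rewrite /F (reindex_inj (mulgI p)) /=; apply: eq_bigr => y _.
  by rewrite (young_coef_rowM y pR) invMg -!mulgA mulKg.
rewrite /F mulr_sumr; apply: eq_bigr => y _.
by rewrite mulgA (young_coef_Mcol _ qC) mulrCA.
Qed.

End Young.

(** * The Specht character as the trace of an idempotent *)

Section Traces.
Local Open Scope ring_scope.

(** Write A = CR with C of full column rank and R of full row rank. Then A^2 = 0 cancels down to RC
    = 0, and tr A = tr RC. *)
Lemma mxtrace_sqr0 (F : fieldType) n (A : 'M[F]_n) : A *m A = 0 -> \tr A = 0.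
Proof.
rewrite -{1 2 3}(mulmx_base A) => A2.
rewrite mxtrace_mulC (_ : row_base A *m col_base A = 0) ?mxtrace0 //.
apply: (row_free_inj (row_base_free A)); apply: (row_full_inj (col_base_full A)).
by rewrite mul0mx mulmx0 -A2 !mulmxA.
Qed.

Lemma mxtrace_submod (F : fieldType) (gT : finGroupType) (G : {group gT}) n
    (rG : mx_representation F G n) (U E : 'M[F]_n) (Umod : mxmodule rG U) x :
  x \in G -> (U :=: E)%MS -> E *m E = E ->
  \tr (submod_repr Umod x) = \tr (E *m rG x).
Proof.
move=> xG UE EE; rewrite /= /submod_mx in_submodE -mulmxA mxtrace_mulC -mulmxA.
(* P and E are two projections onto the same space: P fixes what lies in U, and E fixes what lies in
   the image of P. This allows E to replace P under the trace. *)
set P := (in_submod U 1%:M *m val_submod 1%:M).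
have PE (A : 'M_n) : (A <= U)%MS -> A *m P = A.
  by move=> AU; rewrite mulmxA -in_submodE -val_submodE in_submodK.
have EP : P *m E = P.
  have : (P <= E)%MS by rewrite /P -val_submodE -UE val_submodP.
  by case/submxP=> D ->; rewrite -mulmxA EE.
rewrite -EP mulmxA mxtrace_mulC mulmxA PE //.
by rewrite -(eqmxMr (rG x) UE) (mxmoduleP Umod).
Qed.

Variable m : nat.
Local Notation G := [set: 'S_m].
Local Notation e g := (delta_mx 0 (gring_index G g) : 'rV[algC]_(gcard G)).
Local Notation aG := (regular_repr algC [set: 'S_m]%G).
Implicit Types s t g x y z h : 'S_m.

Definition leftreg_mx g : 'M[algC]_(gcard G) :=
  \matrix_i delta_mx 0 (gring_index G (g * enum_val i)).

Lemma e_leftreg_mx g h : e h *m leftreg_mx g = e (g * h)%g.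
Proof. by rewrite -rowE rowK gring_indexK ?inE. Qed.

Lemma e_regular g h : e h *m aG g = e (h * g)%g.
Proof. by rewrite -rowE rowK gring_indexK ?inE. Qed.

Lemma eq_mx_e k (A B : 'M_(gcard G, k)) : (forall h, e h *m A = e h *m B) -> A = B.
Proof.
by move=> E; apply/row_matrixP=> i; rewrite -(gring_valK i) !rowE E.
Qed.

Lemma leftreg_mxM g h : leftreg_mx g *m leftreg_mx h = leftreg_mx (h * g)%g.
Proof. by apply: eq_mx_e => x; rewrite mulmxA !e_leftreg_mx mulgA. Qed.

Lemma leftreg_mx_regular g s : leftreg_mx g *m aG s = aG s *m leftreg_mx g.
Proof. by apply: eq_mx_e => x; rewrite !mulmxA e_leftreg_mx !e_regular e_leftreg_mx mulgA. Qed.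

Lemma mxtrace_leftreg_mx_regular g s :
  \tr (leftreg_mx g *m aG s) = \sum_x (g * x * s == x)%g%:R.
Proof.
rewrite /mxtrace (reindex (gring_index G)) /=; last first.
  exists enum_val => [x _|i _]; last exact: gring_valK.
  by rewrite gring_indexK ?inE.
apply: eq_bigr => x _.
have -> : (leftreg_mx g *m aG s) (gring_index G x) (gring_index G x) =
   (e x *m (leftreg_mx g *m aG s)) 0 (gring_index G x) by rewrite -rowE [RHS]mxE.
rewrite mulmxA e_leftreg_mx e_regular mxE eqxx /= eq_sym; congr (nat_of_bool _)%:R.
by apply/eqP/eqP=> [/(congr1 enum_val)|->//]; rewrite !gring_indexK ?inE.
Qed.

Variable la : seq nat.
Hypotheses (la_sorted : sorted geq la) (sum_la : sumn la = m).

(** Left multiplication by the symmetrizer c. It commutes with the regular representation and has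
    the right ideal generated by c as row space; divided by [young_scalar] it is the idempotent
    required by [mxtrace_submod]. *)
Definition young_mx : 'M[algC]_(gcard G) := \sum_g young_coef la g *: leftreg_mx g.

Lemma young_mx_sqr : young_mx *m young_mx = young_scalar m la *: young_mx.
Proof.
rewrite /young_mx mulmx_suml scaler_sumr.
under eq_bigr => g _ do rewrite mulmx_sumr.
under eq_bigr => g _ do rewrite (reindex_inj (mulIg g^-1%g)) /=.
rewrite exchange_big /=; apply: eq_bigr => x _.
(* Products of left multiplications come out reversed, so the convolution needed here has the shape
   of [young_coef_sandwich] with its last argument equal to 1. *)
rewrite scalerA -[young_scalar m la * _]mulr1 -(young_coef1 m la) -young_coef_sandwich // scaler_suml.
apply: eq_bigr => g _; rewrite -scalemxAl -scalemxAr scalerA leftreg_mxM.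
by rewrite mulgKV mulg1.
Qed.

Lemma mxtrace_young_mx_regular s :
  \tr (young_mx *m aG s) = \sum_x young_coef la (x * s^-1 * x^-1)%g.
Proof.
rewrite mulmx_suml raddf_sum /=.
under eq_bigr => g _ do rewrite -scalemxAl mxtraceZ mxtrace_leftreg_mx_regular mulr_sumr.
rewrite exchange_big /=; apply: eq_bigr => x _.
rewrite (bigD1 (x * s^-1 * x^-1)%g) //= !mulgKV eqxx mulr1 big1 ?addr0 // => g gx.
case: eqP => [E|]; last by rewrite mulr0.
by case/eqP: gx; apply: (@mulIg _ (x * s)%g); rewrite !mulgA E !mulgKV.
Qed.

(** Otherwise [young_mx] would have square zero and trace 0, but its trace is m! because
    [young_coef] is 1 at the identity. *)
Lemma young_scalar_neq0 : young_scalar m la != 0.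
Proof.
apply/eqP=> n0; have := young_mx_sqr; rewrite n0 scale0r => /mxtrace_sqr0.
have := mxtrace_young_mx_regular 1; rewrite repr_mx1 mulmx1 => ->.
under eq_bigr do rewrite invg1 mulg1 mulgV young_coef1.
by move/eqP; rewrite sumr_const -mulr_natl mulr1 pnatr_eq0 card_Sn -leqn0 leqNgt fact_gt0.
Qed.

Lemma young_symmE : young_symm m la = \sum_g young_coef la g *: e g.
Proof.
rewrite /young_symm; under [RHS]eq_bigr do rewrite scaler_suml.
rewrite [RHS]exchange_big /=; apply: eq_bigr => p _.
under [RHS]eq_bigr do rewrite scaler_suml.
rewrite [RHS]exchange_big /=; apply: eq_bigr => q _.
rewrite (bigD1 (p * q)%g) //= eqxx mulr1 big1 ?addr0 // => g.
by rewrite eq_sym => /negbTE->; rewrite mulr0 scale0r.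
Qed.

Lemma e_young_mx x : e x *m young_mx = young_symm m la *m aG x.
Proof.
rewrite young_symmE mulmx_suml mulmx_sumr; apply: eq_bigr => g _.
by rewrite -scalemxAl -scalemxAr e_leftreg_mx e_regular.
Qed.

Lemma cyclic_young_symm : (cyclic_mx aG (young_symm m la) :=: young_mx)%MS.
Proof.
apply/eqmxP/andP; split.
  apply: cyclic_mx_sub.
    apply/mxmoduleP=> x _; rewrite (_ : young_mx *m aG x = aG x *m young_mx) ?submxMl //.
    rewrite mulmx_suml mulmx_sumr; apply: eq_bigr => g _.
    by rewrite -scalemxAl -scalemxAr leftreg_mx_regular.
  by rewrite -[young_symm m la]mulmx1 -(repr_mx1 aG) -e_young_mx submxMl.
apply/row_subP=> i; rewrite -(gring_valK i) rowE e_young_mx.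
by apply: mxmodule_trans; rewrite ?cyclic_mx_module ?cyclic_mx_id ?inE.
Qed.

Lemma chiE s : chi m la s = (young_scalar m la)^-1 * \sum_x young_coef la (x * s^-1 * x^-1)%g.
Proof.
rewrite /chi cfunE inE mulr1n -mxtrace_young_mx_regular -mxtraceZ scalemxAl.
apply: mxtrace_submod; rewrite ?inE //.
  apply: eqmx_trans cyclic_young_symm _; apply: eqmx_sym.
  by apply: eqmx_scale; rewrite invr_eq0 young_scalar_neq0.
rewrite -scalemxAl; congr (_ *: _).
by rewrite -scalemxAr young_mx_sqr scalerA mulVf ?young_scalar_neq0 // scale1r.
Qed.
End Traces.

(** * The Frobenius formula *)

Section Frobenius.
Local Open Scope ring_scope.
Variables (m N : nat) (la : seq nat).
Hypotheses (la_sorted : sorted geq la) (sum_la : sumn la = m) (szla : (size la <= N)%N).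
Local Notation G := [set: 'S_m].
Local Notation word := {ffun 'I_m -> 'I_N}.
Local Notation R := (row_stab m la).
Local Notation C := (col_stab m la).
Implicit Types (s t g x y z : 'S_m) (h : word).

Definition theta_fun s : algC :=
  \sum_(h : word | word_act h s == h) altcoef la (content h).

Lemma theta_funJ s t : theta_fun (s ^ t) = theta_fun s.
Proof.
rewrite /theta_fun (reindex (fun h : word => word_act h t^-1)) /=; last first.
  exact/onW_bij/word_act_bij.
apply: eq_big => h; last by rewrite content_word_act.
by rewrite -word_actM conjgE !mulgA mulgK word_actM (can_eq (word_actK _)).
Qed.

Lemma theta_subproof : is_class_fun <<G>>%g [ffun s => theta_fun s].
Proof.
rewrite genGid; apply: intro_class_fun => [s t _ _|s]; first exact: theta_funJ.
by rewrite inE.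
Qed.

Definition theta : 'CF(G) := Cfun 0 theta_subproof.

Lemma thetaE s : theta s = theta_fun s.
Proof. by rewrite cfunE. Qed.

Lemma conj_altcoef N' c : (@altcoef N' la c)^* = altcoef la c.
Proof.
rewrite /altcoef det_natb rmorph_sum; apply: eq_bigr => w _.
by rewrite rmorphM rmorph_sign rmorph_nat.
Qed.

Lemma theta_real s : (theta s)^* = theta s.
Proof.
by rewrite thetaE rmorph_sum; apply: eq_bigr => h _; exact: conj_altcoef.
Qed.

Lemma theta_jt s : theta s = \sum_(h : word | word_act h s == h) jtcoef la (content h).
Proof. by rewrite thetaE sum_jtcoef_altcoef. Qed.

Lemma thetaV s : theta s^-1%g = theta s.
Proof.
rewrite !thetaE; apply: eq_bigl => h; apply/eqP/eqP=> E.
  by rewrite -[in LHS]E word_actKV.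
by rewrite -[in LHS]E word_actK.
Qed.

(* A product of two word sums is a sum over words in pairs of letters, whose
   contents are N x N matrices. *)
Lemma theta_norm : '[theta] = 1.
Proof.
rewrite cfdotE cardsT card_Sn.
pose F (c : {ffun 'I_N * 'I_N -> nat}) : algC := jtcoef la (rowsum c) * altcoef la (colsum c).
have -> : \sum_(s in G) theta s * (theta s)^* =
    \sum_s \sum_(k : {ffun 'I_m -> 'I_N * 'I_N} | word_act k s == k) F (content k).
  apply: eq_big => [s|s _]; first by rewrite inE.
  (* Since theta is real, its norm is a mean of squares; one factor is expanded with [jtcoef], the
     other with [altcoef]. *)
  rewrite theta_real {1}theta_jt thetaE big_distrlr /= pair_big_dep /=.
  pose f (hh : word * word) : {ffun 'I_m -> 'I_N * 'I_N} := [ffun x => (hh.1 x, hh.2 x)].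
  pose f' (k : {ffun 'I_m -> 'I_N * 'I_N}) : word * word :=
    ([ffun x => (k x).1], [ffun x => (k x).2]).
  have fK : cancel f f'.
    by case=> h h'; congr (_, _); apply/ffunP=> x; rewrite !ffunE.
  have f'K : cancel f' f.
    by move=> k; apply/ffunP=> x; rewrite !ffunE; case: (k x).
  rewrite [RHS](reindex f) /=; last by exists f' => ? _; [apply: fK | apply: f'K].
  apply: eq_big => [[h h']|[h h'] _] /=.
    apply/andP/eqP => [[/eqP E /eqP E']|E].
      apply/ffunP=> x; rewrite !ffunE /=.
      by rewrite -{2}E -{2}E' !ffunE.
    by split; apply/eqP/ffunP=> x; have /ffunP/(_ x) := E; rewrite !ffunE => -[].
  congr (_ * _); [congr (jtcoef la _) | congr (altcoef la _)]; apply/ffunP=> i; rewrite !ffunE.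
    under [RHS]eq_bigr do rewrite ffunE; rewrite [RHS]exchange_big /=.
    apply: eq_bigr => x _; rewrite (bigD1 (h' x)) //= big1 ?addn0 => [|j jx].
      by rewrite ffunE /= -pair_eqE /pair_eq /= eqxx andbT.
    by rewrite ffunE -pair_eqE /pair_eq /= eq_sym [X in _ && X]eq_sym (negbTE jx) andbF.
  under [RHS]eq_bigr do rewrite ffunE; rewrite [RHS]exchange_big /=.
  apply: eq_bigr => x _; rewrite (bigD1 (h x)) //= big1 ?addn0 => [|j jx].
    by rewrite ffunE /= -pair_eqE /pair_eq /= eqxx.
  by rewrite ffunE -pair_eqE /pair_eq /= eq_sym (negbTE jx).
rewrite sum_fixed_words mulrA mulVf ?mul1r; last by rewrite pnatr_eq0 -lt0n fact_gt0.
exact: sum_jt_alt.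
Qed.

Lemma young_coef_real g : (young_coef la g)^* = young_coef la g.
Proof.
rewrite rmorph_sum; apply: eq_bigr => p _; rewrite rmorph_sum; apply: eq_bigr => q _.
by rewrite rmorphM rmorph_sign rmorph_nat.
Qed.

Lemma young_scalar_real : (young_scalar m la)^* = young_scalar m la.
Proof.
by rewrite rmorph_sum; apply: eq_bigr => g _; rewrite rmorphM /= !young_coef_real.
Qed.

Lemma chi_real s : (chi m la s)^* = chi m la s.
Proof.
rewrite chiE // rmorphM fmorphV /= young_scalar_real rmorph_sum; congr (_ * _).
by apply: eq_bigr => x _; exact: young_coef_real.
Qed.

(* The character of the right ideal c A, with c^2 = n c, pairs with a class
   function f to the value of f at the inverse of c / n. *)
Lemma cfdot_chi (f : 'CF(G)) :
  (forall s, (f s)^* = f s) ->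
  '[chi m la, f] = (young_scalar m la)^-1 * \sum_g young_coef la g * f g^-1%g.
Proof.
move=> f_real; rewrite cfdotE cardsT card_Sn.
have -> : \sum_(s in G) chi m la s * (f s)^* =
    (young_scalar m la)^-1 * \sum_(x : 'S_m) \sum_g young_coef la g * f g^-1%g.
  rewrite (eq_bigl predT) => [|s]; last by rewrite inE.
  under eq_bigr => s _ do rewrite chiE // f_real -mulrA mulr_suml.
  rewrite -mulr_sumr exchange_big /=; congr (_ * _); apply: eq_bigr => x _.
  rewrite (reindex_inj (inj_comp (conjg_inj x) invg_inj)) /=.
  apply: eq_bigr => g _; rewrite conjgE; congr (young_coef la _ * _).
    by rewrite !invMg !invgK !mulgA mulgV mul1g mulgK.
  by rewrite -conjgE cfunJ ?inE.
rewrite sumr_const card_Sn -[(\sum_g _) *+ m`!]mulr_natl mulrCA mulKf //.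
by rewrite pnatr_eq0 -lt0n fact_gt0.
Qed.

(** After [chiE], the sum over g for fixed x is n c(x) c(x^-1) by the sandwich identity, n being
    [young_scalar]; summing over x gives n^2, which cancels the two factors 1/n. *)
Lemma chi_norm : '[chi m la] = 1.
Proof.
rewrite (cfdot_chi chi_real).
under eq_bigr => g _ do rewrite char_inv ?cfRepr_char // chi_real chiE // mulrCA mulr_sumr.
rewrite -mulr_sumr exchange_big /=; under eq_bigr => x _ do rewrite young_coef_sandwich // -mulrA.
by rewrite -mulr_sumr -/(young_scalar m la) mulKf ?mulVf ?young_scalar_neq0.
Qed.

(** Right multiplication by a column transposition that fixes h preserves the stabilizer of h and
    changes the sign of [young_coef]. *)
Lemma young_coef_fixed_eq0 h : ~~ col_distinct la h ->
  \sum_(s | word_act h s == h) young_coef la s = 0.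
Proof.
case/col_distinct_tperm=> x [y [xy tC hxy]]; set S := LHS.
have ht : word_act h (tperm x y) = h.
  by apply/ffunP=> z; rewrite ffunE; case: tpermP => // ->.
have : S = - S.
  rewrite {1}/S (reindex_inj (mulIg (tperm x y))) -sumrN /=.
  apply: eq_big => s; first by rewrite word_actM ht.
  by rewrite young_coef_Mcol // odd_tperm xy mulN1r.
by move/eqP; rewrite -addr_eq0 -mulr2n mulrn_eq0 /= => /eqP.
Qed.

Local Notation rho := (rowword sum_la szla).

(** The stabilizer of [word_act rho q] consists of the q p q^-1 with p in R, where c(q p q^-1) =
    sgn(q) c(q p). Expanding one factor of [young_scalar] gives the same double sum over p and q. *)
Lemma sum_young_coef_fixed_rowword :
  \sum_(q in C) \sum_(s | word_act (word_act rho q) s == word_act rho q) young_coef la s =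
  young_scalar m la.
Proof.
rewrite /young_scalar; under [RHS]eq_bigr => y _ do rewrite mulrC {1}/young_coef mulr_suml.
rewrite [RHS]exchange_big /=.
under [RHS]eq_bigr => p _.
  under eq_bigr => y _ do rewrite mulr_suml.
  rewrite exchange_big /=.
  under eq_bigr => q _.
    rewrite (bigD1 (p * q)^-1%g) //= invgK eqxx mulr1 big1 ?addr0 => [|y yp]; last first.
      case: eqP => [E|]; last by rewrite mulr0 mul0r.
      by case/eqP: yp; rewrite E invgK.
    over.
  over.
rewrite [RHS]exchange_big [RHS](reindex_inj invg_inj) /=.
apply: eq_big => [q|q qC]; first by rewrite groupV.
rewrite [RHS](reindex_inj invg_inj) /= (reindex_inj (conjg_inj q^-1%g)) /=.
apply: eq_big => [p|p _].
  rewrite groupV -word_actM conjgE invgK !mulgA mulgKV word_actM (can_eq (word_actK q)).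
  exact/eqP/(row_stabP sum_la szla).
by rewrite odd_permV invMg !invgK conjgE invgK mulgA young_coef_Mcol ?groupV // odd_permV.
Qed.

Lemma cfdot_chi_theta : '[chi m la, theta] = 1.
Proof.
rewrite (cfdot_chi theta_real).
under eq_bigr => g _ do rewrite thetaV theta_jt mulr_sumr.
rewrite (exchange_big_dep predT) //=.
pose Z h := \sum_(s | word_act h s == h) young_coef la s.
rewrite (eq_bigr (fun h => jtcoef la (content h) * Z h)) => [|h _]; last first.
  by rewrite mulr_sumr; apply: eq_bigr => s _; rewrite mulrC.
have rho_inj : {in C &, injective (word_act rho)}.
  move=> p q /col_stabP pC /col_stabP qC /ffunP E; apply/permP=> x.
  apply: (@cell_inj _ la); last by rewrite pC qC.
  by have := E x; rewrite !ffunE => /(congr1 val).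
(* Only the column permutations of rho contribute: a nonzero Z makes h column distinct, a nonzero
   [jtcoef] bounds its content from below, and together they force the content la. *)
rewrite (bigID (mem (word_act rho @: C))) /= addrC big1 ?add0r => [|h hC]; last first.
  apply/eqP; rewrite mulf_eq0; apply/norP=> -[jt0 Z0].
  have cd : col_distinct la h by apply: contraNT Z0 => ncd; rewrite /Z young_coef_fixed_eq0.
  case/negP: hC; have [i|q qC ->] := col_distinct_rowwordE la_sorted sum_la szla cd.
    move: i; apply: partial_sums_inj => k; apply/eqP; rewrite eqn_leq.
    by rewrite (col_distinct_psum la_sorted sum_la szla) // (jtcoef_psum la_sorted k jt0).
  exact: imset_f.
rewrite big_imset //=.
rewrite (eq_bigr (fun q => Z (word_act rho q))) => [|q _]; last first.
  rewrite jtcoef_self ?mul1r // => i.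
  by rewrite content_word_act content_rowword.
by rewrite sum_young_coef_fixed_rowword mulVf ?young_scalar_neq0.
Qed.

Lemma chi_theta : chi m la = theta.
Proof.
apply/eqP; rewrite -subr_eq0 -cfnorm_eq0 cfnormB chi_norm theta_norm cfdot_chi_theta.
by rewrite rmorph1 -mulr2n subrr.
Qed.

End Frobenius.

Theorem chi_altcoef m N la (s : 'S_m) :
  sorted geq la -> sumn la = m -> size la <= N ->
  (chi m la s = \sum_(h : {ffun 'I_m -> 'I_N} | word_act h s == h) altcoef la (content h))%R.
Proof. by move=> la_sorted sum_la szla; rewrite (chi_theta la_sorted sum_la szla) thetaE. Qed.

(** * The induced character *)

Lemma altcoef_sum (N : nat) (la : seq nat) (c : {ffun 'I_N -> nat}) :
  size la <= N -> (altcoef la c != 0)%R -> \sum_i c i = sumn la.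
Proof.
move=> szla /det_natb_neq0[w cw]; rewrite -(sum_nth_sumn szla).
apply/eqP; rewrite -(eqn_add2r (\sum_(i < N) (N - i.+1))) -!big_split /=.
rewrite [X in _ == X](reindex_inj (@perm_inj _ w)) /=; apply/eqP.
by apply: eq_bigr => i _; rewrite (eqP (cw i)).
Qed.

Section RestrictedWords.
Local Open Scope ring_scope.
Variables (n a : nat).
Implicit Types (b : 'S_n) (B : {set 'I_n}).

(** Words on B become words on all of ['I_n] with the default letter [ord0] off B, which removes the
    type ['I_#|B|] and lets several blocks be treated together. *)
Lemma sum_restrict_words b B (F : {ffun 'I_a.+1 -> nat} -> algC) : b @: B = B ->
  \sum_(h : {ffun 'I_#|B| -> 'I_a.+1} | word_act h (restrict B b) == h) F (content h) =
  \sum_(g : {ffun 'I_n -> 'I_a.+1} |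
          [forall x, if x \in B then g (b x) == g x else g x == ord0])
     F [ffun i => \sum_(x in B) (g x == i)]%N.
Proof.
move=> bB; have bBE x : (b x \in B) = (x \in B).
  by rewrite -{1}bB mem_imset //; apply: perm_inj.
pose ext (h : {ffun 'I_#|B| -> 'I_a.+1}) : {ffun 'I_n -> 'I_a.+1} :=
  [ffun x => if [pick k : 'I_#|B| | enum_val k == x] is Some k then h k else ord0].
pose res (g : {ffun 'I_n -> 'I_a.+1}) : {ffun 'I_#|B| -> 'I_a.+1} :=
  [ffun k => g (enum_val k)].
have extE h k : ext h (enum_val k) = h k.
  rewrite ffunE; case: pickP => [k' /eqP/enum_val_inj->//|none].
  by have := none k; rewrite eqxx.
have ext0 h x : x \notin B -> ext h x = ord0.
  move=> xB; rewrite ffunE; case: pickP => // k /eqP E.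
  by case/negP: xB; rewrite -E; apply: enum_valP.
have enumB x : x \in B -> exists k : 'I_#|B|, x = enum_val k.
  by move=> xB; exists (enum_rank_in xB x); rewrite enum_rankK_in.
rewrite [RHS](reindex_onto ext res) /= => [|g /forallP gP]; last first.
  apply/ffunP=> x; have := gP x; case: ifPn => [/enumB[k ->] _|xB /eqP->].
    by rewrite extE ffunE.
  exact: ext0.
apply: eq_big => h; last first.
  move=> _; congr F; apply/ffunP=> i; rewrite !ffunE [RHS]big_enum_val /=.
  by apply: eq_bigr => k _; rewrite extE.
rewrite (_ : res (ext h) == h); last first.
  by apply/eqP/ffunP=> k; rewrite ffunE extE.
rewrite andbT; apply/eqP/forallP => [E x|E].
  case: ifPn => [/enumB[k ->]|xB]; last by rewrite ext0.
  by rewrite -restrictE // !extE; have /ffunP/(_ k) := E; rewrite ffunE => ->.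
apply/ffunP=> k; have := E (enum_val k).
by rewrite enum_valP -restrictE // !extE => /eqP E'; rewrite ffunE.
Qed.

Variable r : nat.
Variable bl : {ffun 'I_n -> 'I_r}.
Local Notation word := {ffun 'I_n -> 'I_r * 'I_a.+1}.

Definition fst_word (K : word) : {ffun 'I_n -> 'I_r} := [ffun x => (K x).1].

Definition subcontent (c : {ffun 'I_r * 'I_a.+1 -> nat}) (j : 'I_r) : {ffun 'I_a.+1 -> nat} :=
  [ffun i => c (j, i)].

Lemma prod_sum_restrict_words b (F : 'I_r -> {ffun 'I_a.+1 -> nat} -> algC)
    (B := fun j => [set x | bl x == j]) :
  word_act bl b = bl ->
  \prod_j (\sum_(h : {ffun 'I_#|B j| -> 'I_a.+1} | word_act h (restrict (B j) b) == h)
              F j (content h)) =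
  \sum_(K : word | (word_act K b == K) && (fst_word K == bl))
    \prod_j F j (subcontent (content K) j).
Proof.
move=> blb; have blbE x : bl (b x) = bl x by have /ffunP/(_ x) := blb; rewrite ffunE.
have bB j : b @: B j = B j.
  apply/setP=> x; rewrite -{1}(permKV b x) mem_imset ?inE; last exact: perm_inj.
  by rewrite -{2}(permKV b x) blbE.
under eq_bigr => j _ do rewrite sum_restrict_words //.
rewrite bigA_distr_big_dep /=.
(* A family of words, one per block, is the same as one word in pairs whose first components name
   the blocks. *)
pose glue (f : {ffun 'I_r -> {ffun 'I_n -> 'I_a.+1}}) : word :=
  [ffun x => (bl x, f (bl x) x)].
pose cut (K : word) : {ffun 'I_r -> {ffun 'I_n -> 'I_a.+1}} :=
  [ffun j => [ffun x => if bl x == j then (K x).2 else ord0]].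
rewrite (reindex_onto cut glue) /= => [|f /familyP fP]; last first.
  apply/ffunP=> j; apply/ffunP=> x; rewrite !ffunE /=.
  have := fP j; rewrite unfold_in => /forallP/(_ x); rewrite inE.
  by case: eqP => [->|_ /eqP->].
apply: eq_big => K.
  have -> : (glue (cut K) == K) = (fst_word K == bl).
    apply/eqP/eqP => /ffunP E; apply/ffunP=> x; have := E x; rewrite !ffunE /=.
      by move=> <-.
    by rewrite eqxx => <-; case: (K x).
  apply: andb_id2r => /eqP/ffunP KE; apply/familyP/eqP => [fP|/ffunP E j].
    apply/ffunP=> x; rewrite ffunE; have := KE x; have := KE (b x).
    have := fP (bl x); rewrite unfold_in => /forallP/(_ x).
    rewrite inE eqxx !ffunE blbE eqxx => /eqP E1 E2 E3.
    by rewrite [LHS]surjective_pairing [RHS]surjective_pairing E1 E2 E3.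
  rewrite unfold_in; apply/forallP=> x; rewrite inE !ffunE blbE.
  by case: eqP => //= _; have := E x; rewrite ffunE => ->.
case/andP=> _ /eqP/ffunP KE; apply: eq_bigr => j _; congr (F j _).
apply/ffunP=> i; rewrite !ffunE [LHS]big_mkcond /=; apply: eq_bigr => x _.
have : (K x).1 = bl x by rewrite -KE ffunE.
rewrite inE ffunE; case: (K x) => j' i' /= ->; rewrite -pair_eqE /pair_eq /=.
by case: eqP.
Qed.
End RestrictedWords.

(** * Evaluation of the induced character *)

Section Induced.
Local Open Scope ring_scope.
Variables (r n : nat).
Local Notation W := (wreath r n).
Local Notation wperm := {perm 'I_n * Zmod r}.
Implicit Types (p q y : wperm) (s t : 'S_n).

Definition lift_fun s (v : 'I_n * Zmod r) : 'I_n * Zmod r := (s v.1, v.2).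

Lemma lift_fun_inj s : injective (lift_fun s).
Proof. by case=> i z [i' z'] [/perm_inj-> ->]. Qed.

Definition lift_wperm s : wperm := perm (@lift_fun_inj s).

Lemma lift_wperm_wreath s : lift_wperm s \in W.
Proof. by apply/wreathP=> i z x; rewrite !permE. Qed.

Lemma base_lift_wperm s : base (lift_wperm s) = s.
Proof. by apply/permP=> i; rewrite baseE ?lift_wperm_wreath // permE. Qed.

(** The fibres of [base] are the translates of its kernel by the [lift_wperm s], so they have equal
    cardinality. *)
Lemma sum_wreath_base (f : 'S_n -> algC) :
  \sum_(y in W) f (base y) = #|[set y in W | base y == 1%g]|%:R * \sum_s f s.
Proof.
rewrite (partition_big (@base r n) predT) //= mulr_sumr; apply: eq_bigr => s _.
rewrite (eq_bigr (fun=> f s)) => [|y /andP[_ /eqP->] //].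
rewrite sumr_const mulr_natl; congr (_ *+ _).
rewrite -[in RHS](card_imset _ (mulgI (lift_wperm s))); apply: eq_card => y.
rewrite unfold_in /=; apply/andP/imsetP=> [[yW /eqP ys]|[x]]; last first.
  rewrite inE => /andP[xW /eqP x1] ->.
  by rewrite groupM ?lift_wperm_wreath // baseM ?lift_wperm_wreath // x1 mulg1 base_lift_wperm.
exists ((lift_wperm s)^-1 * y)%g; last by rewrite mulKVg.
rewrite inE groupM ?groupV ?lift_wperm_wreath //=; apply/eqP.
apply: (mulgI (base (lift_wperm s))).
by rewrite -baseM ?groupM ?groupV ?lift_wperm_wreath // mulKVg ys base_lift_wperm mulg1.
Qed.

Lemma base_conj p y : p \in W -> y \in W -> base (p ^ y) = (base p ^ base y)%g.
Proof.
move=> pW yW; apply: (mulgI (base y)); rewrite -conjgC -!baseM ?groupJ //.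
by rewrite -conjgC.
Qed.

Lemma sum_color_stable p (A : {set 'I_n}) :
  (forall c, c \in porbits (base p) -> \sum_(i in c) color p i = 0) ->
  (forall i, (base p i \in A) = (i \in A)) -> \sum_(i in A) color p i = 0.
Proof.
move=> p0 pA; rewrite (partition_big (fun i => porbit (base p) i) predT) //=.
apply: big1 => c _.
have [/existsP[i0 /andP[i0A /eqP <-]]|noi] :=
    boolP [exists i, (i \in A) && (porbit (base p) i == c)]; last first.
  apply: big_pred0 => i; apply/negbTE; apply: contra noi => H.
  by apply/existsP; exists i.
rewrite -[RHS](p0 (porbit (base p) i0)) ?imset_f //; apply: eq_bigl => i.
rewrite eq_porbit_mem andb_idl // => /porbitP[k ->].
by elim: k => [|k IH]; rewrite ?perm1 // expgSr permM pA.
Qed.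

(** Up to relabelling by y, conjugation changes the color function by the difference of [color y] at
    [base p i] and at i, which sums to 0 over a set stable under [base p]; that set is a union of
    cycles of color 0. *)
Lemma sum_color_conj p y (A : {set 'I_n}) : p \in W -> y \in W ->
  (forall c, c \in porbits (base p) -> \sum_(i in c) color p i = 0) ->
  base (p ^ y) @: A = A -> \sum_(i in A) color (p ^ y)%g i = 0.
Proof.
move=> pW yW p0 qA; have qW : (p ^ y)%g \in W by rewrite groupJ.
set q := (p ^ y)%g in qA qW *.
have yq : (y * q = p * y)%g by rewrite /q -conjgC.
have qAE i : (base q i \in A) = (i \in A).
  by rewrite -{1}qA mem_imset //; apply: perm_inj.
pose A' := [set i | base y i \in A].
have A'E i : (base p i \in A') = (i \in A').
  rewrite !inE -[base y (base p i)]permM -baseM // -yq baseM // permM qAE //.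
have colE i : color q (base y i) = color p i + color y (base p i) - color y i.
  by rewrite -colorM // -yq colorM // addrC addKr.
rewrite (reindex_inj (@perm_inj _ (base y))) /= (eq_bigl [in A']) => [|i]; last first.
  by rewrite [in RHS]inE.
rewrite (eq_bigr _ (fun i _ => colE i)) sumrB big_split /= (sum_color_stable p0 A'E) add0r.
apply/eqP; rewrite subr_eq0; apply/eqP.
rewrite [RHS](reindex_inj (@perm_inj _ (base p))) /=.
by apply: eq_bigl => i; rewrite A'E.
Qed.

Section Psi.
Variables (a : nat) (la : r.-tuple (seq nat)).
Hypotheses (la_multi : is_multipart n la) (szla : forall j, (size (tnth la j) <= a.+1)%N).

Lemma multipart_sorted j : sorted geq (tnth la j).
Proof.
by case/andP: la_multi => /allP/(_ _ (mem_tnth j la))/andP[].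
Qed.

Lemma multipart_sum : sumn (map sumn la) = n.
Proof. by case/andP: la_multi => _ /eqP. Qed.

Lemma multipart_size : (size (map sumn la) <= r)%N.
Proof. by rewrite size_map size_tuple. Qed.

(** The tableau constructions are reused with the sequence of block sizes as shape: its rows are the
    blocks, and the block subgroup is the preimage under [base] of the stabilizer of this word. *)
Definition blockword := rowword multipart_sum multipart_size.

Lemma blockE j : block n la j = [set x | blockword x == j].
Proof. by apply/setP=> x; rewrite !inE ffunE -(inj_eq val_inj). Qed.

Lemma content_blockword j : content blockword j = sumn (tnth la j).
Proof.
by rewrite content_rowword (nth_map [::]) ?size_tuple // -tnth_nth.
Qed.

Lemma card_block j : #|block n la j| = sumn (tnth la j).
Proof.
rewrite -content_blockword ffunE blockE -sum1_card big_mkcond /=.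
by apply: eq_bigr => x _; rewrite inE; case: eqP.
Qed.

Lemma block_stableE s :
  [forall j, s @: block n la j == block n la j] = (word_act blockword s == blockword).
Proof.
apply/forallP/eqP => [E|/ffunP E j].
  apply/ffunP=> x; rewrite ffunE; apply/eqP.
  have : s x \in block n la (blockword x).
    by rewrite -(eqP (E _)) imset_f // blockE inE.
  by rewrite blockE inE.
apply/eqP/setP=> x; rewrite -{1}(permKV s x) mem_imset; last exact: perm_inj.
by rewrite !blockE !inE -E ffunE permKV.
Qed.

Definition blockprod (K : {ffun 'I_n -> 'I_r * 'I_a.+1}) : algC :=
  \prod_j altcoef (tnth la j) (subcontent (content K) j).

(** Cycles of color 0 give every stable block total color 0, so the powers of omega are all 1 and a
    product of symmetric group characters remains. If some block is not stable, both sides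
    vanish. *)
Lemma block_char_words p y : p \in W -> y \in W ->
  (forall c, c \in porbits (base p) -> \sum_(i in c) color p i = 0) ->
  block_char n la (p ^ y)%g =
  \sum_(K | (word_act K (base p ^ base y)%g == K) && (fst_word K == blockword)) blockprod K.
Proof.
move=> pW yW p0; rewrite cfunE inE groupJ //= block_stableE base_conj //.
have [stab|nstab] := boolP (word_act blockword (base p ^ base y)%g == blockword); last first.
  rewrite mulr0n big_pred0 // => K; apply/negP=> /andP[/eqP/ffunP E /eqP/ffunP E'].
  case/eqP: nstab; apply/ffunP=> x; rewrite ffunE -!E' !ffunE.
  by have := E x; rewrite ffunE => ->.
rewrite mulr1n -(prod_sum_restrict_words (fun j => altcoef (tnth la j))); last exact/eqP.
apply: eq_bigr => j _; rewrite -blockE sum_color_conj //; last first.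
  by move: stab; rewrite -block_stableE base_conj // => /forallP/(_ j)/eqP.
rewrite /= muln0 expr0 mul1r base_conj //.
apply: chi_altcoef; rewrite ?multipart_sorted ?szla //.
by rewrite card_block.
Qed.

Lemma content_fst_word (K : {ffun 'I_n -> 'I_r * 'I_a.+1}) j :
  content (fst_word K) j = (\sum_i content K (j, i))%N.
Proof.
under [RHS]eq_bigr do rewrite ffunE.
rewrite ffunE [RHS]exchange_big /=; apply: eq_bigr => x _.
rewrite ffunE (bigD1 (K x).2) //= big1 ?addn0 => [|i ix].
  by rewrite -pair_eqE /pair_eq /= eqxx andbT.
by rewrite -pair_eqE /pair_eq /= [X in _ && X]eq_sym (negbTE ix) andbF.
Qed.

Lemma blockprod_word_act (K : {ffun 'I_n -> 'I_r * 'I_a.+1}) s :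
  blockprod (word_act K s) = blockprod K.
Proof. by rewrite /blockprod content_word_act. Qed.

Theorem psi_words p : p \in W ->
  (forall c, c \in porbits (base p) -> \sum_(i in c) color p i = 0) ->
  psi n la p = \sum_(K : {ffun 'I_n -> 'I_r * 'I_a.+1} | word_act K (base p) == K) blockprod K.
Proof.
move=> pW p0; set b := base p.
have sHW : block_subgroup n la \subset W by apply/subsetP=> q; rewrite inE => /andP[].
rewrite /psi cfIndE //.
set kap := #|[set y in W | base y == 1%g]|.
set S := #|[set s | word_act blockword s == blockword]|.
have cardH : #|block_subgroup n la|%:R = (kap * S)%:R :> algC.
  have -> : #|block_subgroup n la|%:R =
      \sum_(y in W) (word_act blockword (base y) == blockword)%:R :> algC.
    rewrite -sum1_card natr_sum big_mkcond [RHS]big_mkcond; apply: eq_bigr => y _ /=.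
    by rewrite inE block_stableE; case: (y \in W) => //=; case: eqP.
  rewrite (sum_wreath_base (fun s => (word_act blockword s == blockword)%:R)) natrM.
  congr (_ * _); rewrite -natr_sum /S -sum1_card [in RHS]big_mkcond /=; congr _%:R.
  by apply: eq_bigr => s _; rewrite inE; case: eqP.
rewrite (eq_bigr _ (fun y yW => block_char_words pW yW p0)) cardH.
rewrite (sum_wreath_base (fun s =>
  \sum_(K | (word_act K (b ^ s)%g == K) && (fst_word K == blockword)) blockprod K)).
have -> : \sum_s \sum_(K | (word_act K (b ^ s)%g == K) && (fst_word K == blockword))
                blockprod K =
   \sum_(K | word_act K b == K) S%:R * blockprod K.
  (* The conjugation by s is transferred from b to the word; s is then constrained only to carry
     [blockword] to the block word of K. *)
  rewrite (eq_bigr (fun s => \sum_(K | (word_act K b == K) &&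
      (word_act blockword s == fst_word K)) blockprod K)) => [|s _]; last first.
    rewrite (reindex (fun K => word_act K s^-1%g)) /=; last exact/onW_bij/word_act_bij.
    apply: eq_big => [K|K _]; last exact: blockprod_word_act.
    rewrite -word_actM conjgE !mulgA mulgK word_actM (can_eq (word_actK _)); congr (_ && _).
    have -> : fst_word (word_act K s^-1%g) = word_act (fst_word K) s^-1%g.
      by apply/ffunP=> x; rewrite !ffunE.
    by rewrite -[in LHS](can_eq (word_actK s)) word_actKV eq_sym.
  rewrite (exchange_big_dep (fun K => word_act K b == K)) /= => [|s K _ /andP[] //].
  apply: eq_bigr => K ->; rewrite /= sumr_const mulr_natl.
  (* For nonzero weight, [altcoef_sum] gives [fst_word K] the content of [blockword], so the number
     of admissible s is the order of the stabilizer, independently of K. *)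
  have [->|Q0] := eqVneq (blockprod K) 0; first by rewrite !mul0rn.
  congr (_ *+ _); rewrite -cardsE; apply: card_word_act_transporter.
  apply/ffunP=> j; rewrite content_blockword content_fst_word.
  have aj : altcoef (tnth la j) (subcontent (content K) j) != 0.
    by apply: contraNneq Q0 => aj0; rewrite /blockprod (bigD1 j) //= aj0 mul0r.
  by rewrite -(altcoef_sum (szla j) aj); apply: eq_bigr => i _; rewrite ffunE.
rewrite -mulr_sumr mulrA -natrM mulKf // pnatr_eq0 muln_eq0 negb_or.
rewrite -!lt0n !card_gt0; apply/andP; split; apply/set0Pn; exists 1%g.
  by rewrite inE group1 base1 /=.
by rewrite inE word_act1.
Qed.
End Psi.
End Induced.

(** * Beta numbers of phi *)

Definition betas (N : nat) (la : seq nat) : seq nat := mkseq (beta N la) N.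

Lemma betas_cons N a la : betas N.+1 (a :: la) = (a + N) :: betas N la.
Proof.
rewrite /betas /mkseq /= /beta /= subn1 (iotaDl 1 0) -map_comp; congr (_ :: _).
Qed.

Lemma mem_betas_nil N x : (x \in betas N [::]) = (x < N).
Proof.
apply/mapP/idP => [[i]|xN]; first by rewrite mem_iota /beta nth_nil; lia.
exists (N - x.+1); first by rewrite mem_iota; lia.
by rewrite /beta nth_nil; lia.
Qed.

Lemma nth_true_cat_true w k x : nth true (w ++ nseq k true) x = nth true w x.
Proof.
rewrite nth_cat; case: ltnP => // le; rewrite nth_nseq if_same.
by rewrite nth_default.
Qed.

Lemma size_boundary la : sorted geq la -> size (boundary la) = size la + head 0 la.
Proof.
elim: la => //= a la IH; rewrite !size_cat size_nseq /= => p.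
have ha : head 0 la <= a by case: la p {IH} => //= b l /andP[].
by rewrite IH ?(path_sorted p) //; lia.
Qed.

(** Beta numbers are the positions of the north steps once the boundary is preceded by enough 0's.
    The default [true] of [nth] stands for an infinite tail of 1's, so trailing 1's never matter. *)
Lemma mem_betas N la x : sorted geq la -> size la <= N ->
  (x \in betas N la) = ~~ nth true (nseq (N - size la) false ++ boundary la) x.
Proof.
elim: la N x => [|a la IH] N x.
  by move=> _ _; rewrite mem_betas_nil subn0 cats0 nth_nseq; case: ltnP.
case: N => // N p; rewrite ltnS => szN.
have s := path_sorted p.
have ha : head 0 la <= a by case: la p {IH szN s} => //= b l /andP[].
rewrite betas_cons inE IH //= subSS catA.
set w := nseq _ _ ++ _; have szw : size w = N + head 0 la.
  by rewrite /w size_cat size_nseq size_boundary // addnA subnK.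
rewrite nth_cat szw; case: ltnP => xw; first by case: eqP => // E; lia.
rewrite [nth true w x]nth_default ?szw // orbF nth_cat size_nseq nth_nseq.
case: ltnP => xa /=; first by apply/negbTE; lia.
case E: (x - _ - _) => [|k] /=; first by apply/eqP; lia.
by rewrite nth_nil; apply/negbTE; lia.
Qed.

Lemma sorted_betas N la : sorted geq la -> sorted gtn (betas N la).
Proof.
move=> s; apply/(sortedP 0) => i; rewrite size_mkseq => iN.
by rewrite !nth_mkseq //= ?beta_lt // ltnW.
Qed.

Lemma gtn_trans : transitive gtn.
Proof. by move=> y x z /= yx zy; apply: ltn_trans zy yx. Qed.

Lemma uniq_betas N la : sorted geq la -> uniq (betas N la).
Proof.
by move=> s; apply: (sorted_uniq gtn_trans) (sorted_betas N s) => x /=; rewrite ltnn.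
Qed.

Lemma betas_shift e N la x : sorted geq la -> size la <= N ->
  (x \in betas (e + N) la) = (x < e) || (x - e \in betas N la).
Proof.
move=> s szN; rewrite !mem_betas // ?(leq_trans szN) ?leq_addl //.
rewrite -addnBA // nseqD -catA [LHS]/= nth_cat size_nseq nth_nseq.
by case: ltnP.
Qed.

(** The 1's among the first k entries number k minus the 0's there, so the anchor condition reads: k
    is the total number of 0's. *)
Lemma anchorE s : anchor s = count_mem false s.
Proof.
set Z := count_mem false s.
have Zs : Z <= size s by apply: count_size.
rewrite /anchor (@eq_in_find _ _ (pred1 Z)).
  rewrite -/(index Z _) -{1}[Z](@nth_iota 0 0 (size s).+1) ?ltnS //.
  by rewrite index_uniq ?iota_uniq // size_iota ltnS.
move=> k; rewrite mem_iota /= ltnS => ks.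
have E1 := count_predC (pred1 true) (take k s).
have E2 : count (predC (pred1 true)) (take k s) = count_mem false (take k s).
  by apply: eq_count => -[].
have E3 : count_mem false (take k s) + count_mem false (drop k s) = Z.
  by rewrite -count_cat cat_take_drop.
rewrite E2 size_takel // in E1; rewrite /=.
move: E1 E3; move: (count_mem true _) (count_mem false _) (count_mem false _) => u v w E1 E3.
by apply/eqP/eqP; lia.
Qed.

Lemma anchor_boundary la : anchor (boundary la) = size la.
Proof.
rewrite anchorE; elim: la => //= a la IH.
by rewrite !count_cat IH count_nseq /= add0n addn0 addn1.
Qed.

Lemma nth_flatten_uniform (T : Type) (x0 : T) (ss : seq (seq T)) r x : 0 < r ->
  (forall s, s \in [seq size s | s <- ss] -> s = r) ->
  nth x0 (flatten ss) x = nth x0 (nth [::] ss (x %/ r)) (x %% r).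
Proof.
move=> r0; elim: ss x => [|s ss IH] x szs; first by rewrite !nth_nil.
have szr : size s = r by apply: szs; rewrite inE eqxx.
rewrite /= nth_cat szr; case: ltnP => xr.
  by rewrite divn_small // modn_small.
rewrite IH => [|k ks]; last by apply: szs; rewrite inE ks orbT.
by rewrite -{3 4}(subnK xr) modnDr divnDr ?dvdnn // divnn r0 addn1.
Qed.

Lemma nth_pad A M s x : nth true (pad A M s) x = nth true (nseq (A - anchor s) false ++ s) x.
Proof. by rewrite /pad catA nth_true_cat_true. Qed.

Lemma size_pad A M s : anchor s <= A -> size s - anchor s <= M -> size (pad A M s) = A + M.
Proof.
have : anchor s <= size s by rewrite anchorE count_size.
by rewrite /pad !size_cat !size_nseq; lia.
Qed.

Lemma nth_interlace (ss : seq bitseq) r T x : 0 < r -> size ss = r ->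
  (forall s, s \in ss -> size s = T) ->
  nth true (interlace ss) x = nth true (nth [::] ss (x %% r)) (x %/ r).
Proof.
move=> r0 szr szT; rewrite -szr in r0 *; rewrite /interlace.
have -> : \max_(s <- ss) size s = T.
  apply/eqP; rewrite eqn_leq; apply/andP; split.
    by apply/bigmax_leqP_seq=> s /szT->.
  have ss0 : nth [::] ss 0 \in ss by apply: mem_nth.
  by rewrite -(szT _ ss0) (leq_bigmax_seq _ ss0).
rewrite (@nth_flatten_uniform _ _ _ (size ss)) //; last first.
  by move=> k; rewrite -map_comp => /mapP[i _ ->] /=; rewrite size_map.
have xr : x %% size ss < size ss by rewrite ltn_mod.
have szx : size (nth [::] ss (x %% size ss)) = T by apply: szT; apply: mem_nth.
have [xT|Tx] := ltnP (x %/ size ss) T.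
  rewrite (nth_map 0) ?size_iota // nth_iota // add0n (nth_map [::]) //.
  by apply: set_nth_default; rewrite szx.
by rewrite [nth [::] (map _ _) _]nth_default ?size_map ?size_iota // nth_nil nth_default ?szx.
Qed.

Lemma drop_find_id s : s = nseq (find id s) false ++ drop (find id s) s.
Proof. by elim: s => [|[] s IH] //=; rewrite {1}IH. Qed.

Lemma drop_find_negb s : s = nseq (find negb s) true ++ drop (find negb s) s.
Proof. by elim: s => [|[] s IH] //=; rewrite {1}IH. Qed.

Lemma trim_split s : exists z t, s = nseq z false ++ trim s ++ nseq t true.
Proof.
exists (find id s); set s1 := drop (find id s) s.
exists (find negb (rev s1)).
rewrite {1}(drop_find_id s); congr (_ ++ _); rewrite /trim -/s1.
rewrite -{1}[s1]revK {1}(drop_find_negb (rev s1)) rev_cat; congr (_ ++ _).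
by rewrite rev_nseq.
Qed.

Section Phi.
Variables (la : seq (seq nat)).
Hypotheses (la_part : all is_part la) (la_gt0 : 0 < size la).
Local Notation r := (size la).

Lemma is_part_sorted l : is_part l -> sorted geq l.
Proof. by case/andP. Qed.

Lemma nth_la_sorted j : sorted geq (nth [::] la j).
Proof.
have [jr|rj] := ltnP j r; last by rewrite nth_default.
by apply: is_part_sorted; apply: (allP la_part); apply: mem_nth.
Qed.

Definition merged_betas a : seq nat :=
  [seq y * r + j | j <- iota 0 r, y <- betas a (nth [::] la j)].

Lemma mem_merged_betas a x :
  (x \in merged_betas a) = (x %/ r \in betas a (nth [::] la (x %% r))).
Proof.
apply/allpairsPdep/idP => [[j [y [jr yb ->]]]|xb].
  move: jr; rewrite mem_iota /= add0n => jr.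
  by rewrite divnMDl // modnMDl divn_small // addn0 modn_small.
exists (x %% r), (x %/ r); rewrite mem_iota ltn_mod la_gt0; split=> //.
exact: divn_eq.
Qed.

Lemma uniq_merged_betas a : uniq (merged_betas a).
Proof.
apply: allpairs_uniq_dep; first exact: iota_uniq.
  by move=> j _; apply: uniq_betas; apply: nth_la_sorted.
move=> [j y] [j' y'] /allpairsPdep[j1 [y1 [jr _ [-> ->]]]].
move=> /allpairsPdep[j2 [y2 [jr' _ [-> ->]]]] /= E.
move: jr jr'; rewrite !mem_iota /= add0n => jr jr'.
have := congr1 (modn^~ r) E; rewrite !modnMDl !modn_small // => jj.
have := congr1 (divn^~ r) E; rewrite !divnMDl // !divn_small // !addn0 => yy.
by rewrite jj yy.
Qed.

Lemma size_merged_betas a : size (merged_betas a) = r * a.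
Proof.
rewrite size_allpairs_dep sumnE big_map; under eq_bigr do rewrite size_mkseq.
by rewrite big_const_seq count_predT size_iota iter_addn_0 mulnC.
Qed.

(** Here z counts the leading 0's removed by [trim]; the removed trailing 1's are invisible to
    [nth true]. *)
Lemma nth_phi : let A := \max_(s <- map boundary la) anchor s in
  exists z, forall x, nth true (nseq z false ++ boundary (phi la)) x =
    nth true (nseq (A - size (nth [::] la (x %% r))) false ++
              boundary (nth [::] la (x %% r))) (x %/ r).
Proof.
move=> A; set M := \max_(s <- map boundary la) (size s - anchor s).
set I := interlace (pad_all (map boundary la)).
have szpad : size (pad_all (map boundary la)) = r by rewrite !size_map.
have [z [t zt]] := trim_split I; exists z => x.
rewrite phi_boundary -/I -[LHS](nth_true_cat_true _ t) -catA -zt.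
rewrite /I (nth_interlace (T := A + M) x la_gt0 szpad); last first.
  move=> s /mapP[w /mapP[l lla ->] ->].
  have bl : boundary l \in map boundary la by apply: map_f.
  by rewrite size_pad // (leq_bigmax_seq _ bl).
have xr : x %% r < r by rewrite ltn_mod.
rewrite /pad_all (nth_map [::]) ?size_map // (nth_map [::]) //.
by rewrite nth_pad anchor_boundary.
Qed.

(** Proved first for A, the common anchor used by the padding, and then for any larger a, where
    adding a - A leading 0's to each component adds r (a - A) to the interlaced sequence. *)
Lemma betas_phi a : (forall l, l \in la -> size l <= a) ->
  size (phi la) <= r * a /\ perm_eq (betas (r * a) (phi la)) (merged_betas a).
Proof.
move=> sza; have [z zE] := nth_phi; move: zE; set A := \max_(s <- _) _ => zE.
have phi_sorted := is_part_sorted (phi_part la).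
have szA j : size (nth [::] la j) <= A.
  have [jr|rj] := ltnP j r; last by rewrite nth_default.
  have bl : boundary (nth [::] la j) \in map boundary la by apply/map_f/mem_nth.
  by rewrite -anchor_boundary (leq_bigmax_seq _ bl).
have Aa : A <= a.
  by apply/bigmax_leqP_seq => s /mapP[l /sza la_l ->] _; rewrite anchor_boundary.
have phiA : perm_eq (betas (z + size (phi la)) (phi la)) (merged_betas A).
  apply: uniq_perm; [exact: uniq_betas | exact: uniq_merged_betas | move=> x].
  rewrite mem_betas ?leq_addl // addnK zE mem_merged_betas mem_betas //.
  exact: nth_la_sorted.
(* The number z of trimmed 0's is recovered by counting the beta numbers on both sides. *)
have zA : z + size (phi la) = r * A.
  by rewrite -size_merged_betas -(perm_size phiA) size_mkseq.
have szphi : size (phi la) <= r * A by rewrite -zA leq_addl.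
split; first by rewrite (leq_trans szphi) // leq_mul2l Aa orbT.
apply: uniq_perm; [exact: uniq_betas | exact: uniq_merged_betas | move=> x].
rewrite mem_merged_betas -(subnK Aa) mulnDr !betas_shift ?nth_la_sorted //.
rewrite -zA (perm_mem phiA) mem_merged_betas ltn_divLR // [_ * r]mulnC.
case: ltnP => //= lex; congr (_ \in betas A (nth _ _ _)).
  by rewrite mulnC divnBMl.
by rewrite -{2}(subnK lex) addnC mulnC modnMDl.
Qed.
End Phi.

(** * Ribbons *)

Lemma sumn_betas N la : size la <= N ->
  sumn (betas N la) = sumn la + \sum_(i < N) (N - i.+1).
Proof.
move=> szN; rewrite sumnE big_map -{1}(subn0 N) -/(index_iota 0 N) big_mkord.
by rewrite -(sum_nth_sumn szN) -big_split.
Qed.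

Lemma sumn_phi la : all is_part la -> 0 < size la ->
  sumn (phi la) = size la * sumn (map sumn la).
Proof.
move=> la_part la0; pose a := \max_(l <- la) size l.
have sza l : l \in la -> size l <= a by move=> lla; rewrite (leq_bigmax_seq _ lla).
have [szphi /perm_sumn] := betas_phi la_part la0 sza.
rewrite sumn_betas //.
(* The empty components serve as reference: their merged beta numbers are delta itself, so
   subtracting the two sums of beta numbers leaves the sizes. *)
pose e : seq (seq nat) := nseq (size la) [::].
have sze : size e = size la by rewrite size_nseq.
have nthe j : nth [::] e j = [::] by rewrite nth_nseq if_same.
have : perm_eq (betas (size la * a) [::]) (merged_betas e a).
  have e_part : all is_part e by apply/allP=> l /nseqP[->].
  have e0 : 0 < size e by rewrite sze.
  apply: uniq_perm => [||x]; [exact: uniq_betas | exact: uniq_merged_betas |].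
  by rewrite mem_merged_betas // nthe !mem_betas_nil ltn_divLR // sze mulnC.
move/perm_sumn; rewrite sumn_betas //= add0n => -> E.
apply/eqP; rewrite -(eqn_add2r (sumn (merged_betas e a))) E; apply/eqP.
rewrite /merged_betas sze !sumnE !big_allpairs_dep /=.
have -> : \sum_(i <- map sumn la) i = \sum_(j <- iota 0 (size la)) sumn (nth [::] la j).
  by rewrite big_map (big_nth [::]) /index_iota subn0.
rewrite big_distrr -big_split /= big_seq [RHS]big_seq; apply: eq_bigr => j.
rewrite mem_iota /= add0n => jr; rewrite nthe !big_split /=.
rewrite -!big_distrl /= -!sumnE (sumn_betas (sza _ (mem_nth _ jr))) (@sumn_betas a [::]) //.
rewrite !big_const_seq !count_predT !size_mkseq /=; lia.
Qed.

Section Ribbon.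
Implicit Types (D : seq (nat * nat)) (c d z : nat * nat).

Lemma mem_skew_cells la la' i j :
  ((i, j) \in skew_cells la la') = (nth 0 la' i <= j < nth 0 la i).
Proof.
apply/allpairsPdep/idP => [[i' [j' [_ jm [-> ->]]]]|ij].
  by move: jm; rewrite mem_iota; lia.
exists i, j; rewrite !mem_iota; split=> //; last by lia.
rewrite /= add0n ltnNge; apply/negP=> szi; move: ij; rewrite (nth_default _ szi); lia.
Qed.

Lemma size_skew_cells la la' : (forall i, nth 0 la' i <= nth 0 la i) ->
  size (skew_cells la la') + sumn la' = sumn la.
Proof.
move=> le; rewrite size_allpairs_dep sumnE big_map.
pose N := maxn (size la) (size la').
rewrite -(@sum_nth_sumn N la) ?leq_maxl // -(@sum_nth_sumn N la') ?leq_maxr //.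
rewrite (eq_bigr (fun i => nth 0 la i - nth 0 la' i)) => [|i _]; last by rewrite size_iota.
have -> : iota 0 (size la) = index_iota 0 (size la) by rewrite /index_iota subn0.
rewrite big_mkord (big_ord_widen N (fun i => nth 0 la i - nth 0 la' i)) ?leq_maxl //.
rewrite big_mkcond -big_split /=; apply: eq_bigr => i _; have := le i.
by case: ltnP => [_|/(nth_default 0)->]; lia.
Qed.

Definition joined D c d := exists p : seq (nat * nat),
  [/\ path adjacent c p, {subset p <= D} & last c p = d].

Lemma joined_refl D c : joined D c c.
Proof. by exists [::]. Qed.

Lemma joined_trans D c d z : joined D c d -> joined D d z -> joined D c z.
Proof.
move=> [p [pP pD pl]] [q [qP qD ql]]; exists (p ++ q); split.
- by rewrite cat_path pP pl.
- by move=> x; rewrite mem_cat => /orP[/pD|/qD].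
- by rewrite last_cat pl.
Qed.

Lemma adjacent_sym : symmetric adjacent.
Proof.
move=> c d; rewrite /adjacent (eq_sym d.1) (eq_sym d.2).
by congr ((_ && _) || (_ && _)); apply: orbC.
Qed.

Lemma joined_sym D c d : c \in D -> joined D c d -> joined D d c.
Proof.
move=> cD [p [pP pD <-]]; exists (rev (belast c p)); split.
- by rewrite rev_path (eq_path (e' := adjacent)) // => x y; rewrite adjacent_sym.
- move=> x; rewrite mem_rev => /mem_belast; rewrite inE => /orP[/eqP->//|/pD//].
- by case: p {pP pD} => //= x p; rewrite rev_cons last_rcons.
Qed.

Lemma joined_step D c d : adjacent c d -> d \in D -> joined D c d.
Proof.
by move=> cd dD; exists [:: d]; split=> //=; [rewrite cd | move=> x; rewrite inE => /eqP->].
Qed.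

Variables (la la' : seq nat) (i0 k0 : nat).
Hypotheses (ik : i0 <= k0)
  (outside : forall t, (t < i0) || (k0 < t) -> nth 0 la' t = nth 0 la t)
  (inside : forall t, i0 <= t < k0 -> (nth 0 la' t).+1 = nth 0 la t.+1)
  (bottom : nth 0 la' k0 < nth 0 la k0)
  (la_sorted : sorted geq la).
Local Notation D := (skew_cells la la').

Lemma ribbon_sub t : nth 0 la' t <= nth 0 la t.
Proof.
have [/outside->//|] := boolP ((t < i0) || (k0 < t)).
rewrite negb_or -!leqNgt => /andP[it]; rewrite leq_eqVlt => /orP[/eqP->|tk].
  exact: ltnW.
have := inside (t := t); rewrite it tk => /(_ isT) E.
by have := nth_part_le la_sorted (leqnSn t); lia.
Qed.

Lemma ribbon_row_left (t c : nat) : (t, c) \in D -> joined D (t, c) (t, nth 0 la' t).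
Proof.
rewrite mem_skew_cells; elim: c => [|c IH] ctD.
  have -> : nth 0 la' t = 0 by lia.
  exact: joined_refl.
have [E|lt] := eqVneq (nth 0 la' t) c.+1; first by rewrite E; apply: joined_refl.
have cD : nth 0 la' t <= c < nth 0 la t by lia.
apply: joined_trans (IH cD); apply: joined_step; last by rewrite mem_skew_cells.
by rewrite /adjacent /= !eqxx orbT.
Qed.

(** From any cell go left to the start of its row; by [inside] the cell just below that one is the
    last cell of the next row. *)
Lemma ribbon_to_bottom (t c : nat) : (t, c) \in D -> joined D (t, c) (k0, nth 0 la' k0).
Proof.
move En : (k0 - t) => n; elim: n t c En => [|n IH] t c En ctD.
  have ? : t = k0.
    apply/eqP; rewrite eqn_leq -[X in _ && X]subn_eq0 En eqxx andbT leqNgt.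
    apply/negP=> kt; move: ctD; rewrite mem_skew_cells outside ?kt ?orbT //; lia.
  by subst t; apply: ribbon_row_left.
have tk : t < k0 by lia.
have it : i0 <= t.
  rewrite leqNgt; apply/negP=> ti; move: ctD; rewrite mem_skew_cells outside ?ti //; lia.
have E := inside (t := t); rewrite it tk in E; have {}E := E isT.
apply: joined_trans (ribbon_row_left ctD) _.
have dD : (t.+1, nth 0 la' t) \in D.
  rewrite mem_skew_cells -E ltnSn andbT.
  have [tk1|tk1] := ltnP t.+1 k0.
    have := inside (t := t.+1); rewrite tk1 leqW // => /(_ isT).
    by have := nth_part_le la_sorted (leqnSn t.+1); lia.
  have kt : k0 = t.+1 by lia.
  by move: bottom; rewrite kt; lia.
apply: joined_trans (joined_step _ dD) _; first by rewrite /adjacent /= !eqxx orbT.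
by apply: IH dD; lia.
Qed.

(** All cells are joined to the bottom left one, and consecutive rows of the shape overlap in
    exactly one column, which excludes squares. *)
Lemma ribbon_skew : ribbon D.
Proof.
split.
- have : (k0, nth 0 la' k0) \in D by rewrite mem_skew_cells leqnn.
  by case: (D).
- move=> c d cD dD; rewrite -/(joined D c d); case: c cD => t c cD; case: d dD => t' d dD.
  apply: joined_trans (ribbon_to_bottom cD) _.
  by apply: joined_sym => //; apply: ribbon_to_bottom.
- case=> i [j []]; rewrite !mem_skew_cells => A B _ C.
  have ii : ~~ ((i < i0) || (k0 < i)) by apply/negP=> /outside; lia.
  have ii' : ~~ ((i.+1 < i0) || (k0 < i.+1)) by apply/negP=> /outside; lia.
  have := inside (t := i); have -> : i0 <= i < k0 by lia.
  move/(_ isT); lia.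
Qed.
End Ribbon.

Lemma sorted_gtn_split b s : sorted gtn s -> b \notin s ->
  s = [seq x <- s | b < x] ++ [seq x <- s | x < b].
Proof.
elim: s => //= x s IH; rewrite (path_sortedE gtn_trans) inE negb_or.
move=> /andP[xs ss] /andP[bx bs].
case: ltngtP bx => // bx _ /=; first by rewrite -IH.
rewrite (_ : [seq y <- s | b < y] = [::]) /=.
  rewrite (@eq_in_filter _ _ predT) ?filter_predT // => y /(allP xs) /= yx.
  by rewrite (ltn_trans yx).
apply/eqP; rewrite -(negbK (_ == _)) -has_filter; apply/hasPn => y /(allP xs) /= yx; lia.
Qed.

Lemma nth_betas N la i : i < N -> nth 0 (betas N la) i = beta N la i.
Proof. exact: nth_mkseq. Qed.

(** Replacing b + r by b in the decreasing list of beta numbers moves the entries Q lying in between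
    one place forward. In terms of parts, each row concerned becomes the next row of la minus one,
    which is the removal of a ribbon; its length is the drop r of the sum of the beta numbers. *)
Lemma peel_betas r N la la' b : 0 < r -> is_part la -> is_part la' ->
  size la <= N -> size la' <= N -> b + r \in betas N la -> b \notin betas N la ->
  (forall x, x \in betas N la' = (x \in betas N la) && (x != b + r) || (x == b)) ->
  peel r la la'.
Proof.
move=> r0 la_p la'_p szla szla' brL bL L'E.
have la_s := is_part_sorted la_p; have la'_s := is_part_sorted la'_p.
have sL := sorted_betas N la_s; have sL' := sorted_betas N la'_s.
have szL : size (betas N la) = N by rewrite size_mkseq.
have [P [Q [S [LE L'E' QS]]]] : exists P Q S,
   [/\ betas N la = P ++ b + r :: Q ++ S, betas N la' = P ++ Q ++ b :: S &
       forall x, x \in Q -> b < x].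
  case/splitPr LE: _ / brL => [P T]; rewrite LE in sL bL.
  move: sL; rewrite (sorted_pairwise gtn_trans) pairwise_cat /= => /and3P[PT sP /andP[bT sT]].
  move: bL; rewrite mem_cat inE !negb_or => /and3P[bP _ bT'].
  have TE := sorted_gtn_split (pairwise_sorted sT) bT'.
  exists P, [seq x <- T | b < x], [seq x <- T | x < b]; split.
  - by rewrite -TE.
  - move: PT; rewrite allrel_consr => /andP[/allP Pbr /allrelP PT].
    apply: (irr_sorted_eq gtn_trans) => // [x /=||x]; first by rewrite ltnn.
      rewrite (sorted_pairwise gtn_trans) pairwise_cat sP /= pairwise_cat /=.
      rewrite !pairwise_filter //= !andbT; apply/and3P; split.
      + apply/allrelP => x y xP; rewrite mem_cat inE !mem_filter.
        case/or3P => [/andP[_ yT]|/eqP->|/andP[_ yT]]; try exact: PT.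
        exact: leq_ltn_trans (leq_addr _ _) (Pbr _ xP).
      + apply/allrelP => x y; rewrite inE !mem_filter => /andP[/= bx _].
        by case/orP => [/eqP->//|/andP[yb _]]; apply: ltn_trans yb bx.
      + by apply/allP=> x; rewrite mem_filter => /andP[].
    rewrite L'E LE !mem_cat !inE.
    have -> : (x \in T) = (x \in [seq x <- T | b < x]) || (x \in [seq x <- T | x < b]).
      by rewrite {1}TE mem_cat.
    have [->|xbr] := eqVneq x (b + r); last first.
      move: (x \in P) (x \in filter _ _) (x \in filter _ _) (x == b).
      by move=> [] [] [] [].
    rewrite andbF /= !mem_filter; have -> : (b + r == b) = false by clear -r0; lia.
    have -> : (b + r \in P) = false by apply/negP=> /Pbr /=; rewrite ltnn.
    have -> : (b + r \in T) = false by apply/negP=> /(allP bT) /=; rewrite ltnn.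
    by rewrite !andbF.
  - by move=> x; rewrite mem_filter => /andP[].
pose i0 := size P; pose k0 := i0 + size Q.
have szN : N = i0 + (size Q + size S).+1 by rewrite -szL LE size_cat /= size_cat.
have betaE t : t < N -> nth 0 la t + (N - t.+1) = nth 0 (P ++ b + r :: Q ++ S) t.
  by move=> tN; rewrite -LE nth_betas.
have betaE' t : t < N -> nth 0 la' t + (N - t.+1) = nth 0 (P ++ Q ++ b :: S) t.
  by move=> tN; rewrite -L'E' nth_betas.
have outside t : (t < i0) || (k0 < t) -> nth 0 la' t = nth 0 la t.
  have [tN|Nt] := ltnP t N; last by rewrite !nth_default // (leq_trans _ Nt).
  move=> tout; have := betaE t tN; rewrite nth_cat.
  have := betaE' t tN; rewrite nth_cat.
  case: ltnP tout => /= [_ _ <- /addIn->//|it kt].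
  have [u tu Qu] : exists2 u, t - size P = u.+1 & size Q <= u.
    by exists (t - size P).-1; move: it kt; rewrite /k0 /i0; lia.
  rewrite tu /= !nth_cat ltnNge (leqW Qu) /= ltnNge Qu /= subSn //=.
  by move=> <- /addIn->.
have inside t : i0 <= t < k0 -> (nth 0 la' t).+1 = nth 0 la t.+1.
  case/andP=> it tk; have tN : t.+1 < N by move: tk; rewrite szN /k0; lia.
  have := betaE t.+1 tN; rewrite nth_cat ltnNge (leqW it) /= subSn //= nth_cat.
  have := betaE' t (ltnW tN); rewrite nth_cat ltnNge it /= nth_cat.
  have -> : t - size P < size Q by move: it tk; rewrite /k0 /i0; lia.
  by move=> <-; lia.
have bottom : nth 0 la' k0 < nth 0 la k0.
  have kN : k0 < N by rewrite szN /k0; lia.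
  rewrite -(ltn_add2r (N - k0.+1)) betaE // betaE' //.
  have nthP X : nth 0 (P ++ X) k0 = nth 0 X (size Q).
    by rewrite nth_cat /k0 /i0 ltnNge leq_addr /= addKn.
  rewrite !nthP nth_cat ltnn subnn /=.
  case: (Q) QS => [|x Q'] QS' /=; first by rewrite -{1}[b]addn0 ltn_add2l.
  by rewrite -cat_cons nth_cat ltnSn; apply: QS'; apply: (mem_nth 0 (s := x :: Q') (n := size Q')).
have sub := ribbon_sub (leq_addr _ _) outside inside bottom la_s.
split=> //; first exact: (ribbon_skew (leq_addr _ _) outside inside bottom la_s).
apply: (@addIn (sumn la')); rewrite size_skew_cells //.
apply: (@addIn (\sum_(i < N) (N - i.+1))).
rewrite -sumn_betas // -addnA -sumn_betas // LE L'E' !sumn_cat /= !sumn_cat /=; lia.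
Qed.

Lemma mem_betasP N la x :
  reflect (exists2 i, i < N & x = beta N la i) (x \in betas N la).
Proof.
apply: (iffP mapP) => -[i]; first by rewrite mem_iota add0n /= => iN ->; exists i.
by move=> iN ->; exists i; rewrite // mem_iota.
Qed.

(** Row t is the last nonzero row, so the beta numbers after it are those of delta and lie below y;
    lowering y + 1 to y is therefore possible. *)
Lemma betas_remove_cell a (l l' : seq nat) t :
  sorted geq l -> t < a -> (forall i, t < i -> nth 0 l i = 0) -> 0 < nth 0 l t ->
  (forall i, nth 0 l' i = if i == t then (nth 0 l i).-1 else nth 0 l i) ->
  exists y, [/\ y.+1 \in betas a l, y \notin betas a l &
    forall x, (x \in betas a l') = (x \in betas a l) && (x != y.+1) || (x == y)].
Proof.
move=> ls ta l0 lt lE; pose y := (nth 0 l t).-1 + (a - t.+1).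
have yE : beta a l t = y.+1 by rewrite /beta /y; lia.
have betaE i : beta a l' i = if i == t then y else beta a l i.
  by rewrite /beta lE; case: eqP => // ->.
have ne i : i < a -> i != t -> beta a l i != y.+1.
  rewrite -yE neq_ltn => ia /orP[it|ti].
    by rewrite gtn_eqF // beta_lt.
  by rewrite ltn_eqF // beta_lt.
exists y; split.
- by apply/mem_betasP; exists t.
- apply/mem_betasP=> -[i ia]; have [it|ti|->] := ltngtP i t.
  + by have := beta_lt ls it ta; rewrite yE; lia.
  + by rewrite /beta l0 // /y; lia.
  by rewrite yE; lia.
move=> x; apply/mem_betasP/orP => [[i ia ->]|[/andP[/mem_betasP[i ia ->] xy]|/eqP->]].
- rewrite betaE; case: ifPn => [_|it]; first by right.
  by left; rewrite ne // andbT; apply/mem_betasP; exists i.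
- exists i => //; rewrite betaE ifN //.
  by apply: contraNneq xy => ->; rewrite yE.
by exists t; rewrite // betaE eqxx.
Qed.

Lemma geq_trans : transitive geq.
Proof. by move=> y x z /= yx zy; apply: leq_trans zy yx. Qed.

Lemma part_remove_cell l : is_part l -> l != [::] ->
  exists l' t, [/\ is_part l', size l' <= size l, (sumn l').+1 = sumn l,
    t < size l & [/\ forall i, t < i -> nth 0 l i = 0, 0 < nth 0 l t &
    forall i, nth 0 l' i = if i == t then (nth 0 l i).-1 else nth 0 l i]].
Proof.
case/lastP: l => // mu c; rewrite /is_part mem_rcons inE negb_or.
move=> /and3P[ls c0 mu0] _.
have mus : sorted geq mu by apply: (subseq_sorted geq_trans _ ls); apply: subseq_rcons.
have nth_c i : nth 0 (rcons mu c) i = if i == size mu then c else nth 0 mu i.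
  by rewrite nth_rcons; case: ltngtP => // lt; rewrite nth_default // ltnW.
pose l' := if c == 1 then mu else rcons mu c.-1.
have c_gt0 : 0 < c by rewrite lt0n eq_sym.
exists l', (size mu); rewrite size_rcons nth_c eqxx; split=> //.
- rewrite /l'; case: eqP => c1; first by rewrite mus mu0.
  rewrite mem_rcons inE negb_or mu0 andbT; apply/andP; split; last by lia.
  have : sorted geq (mu ++ [:: c]) by rewrite cats1.
  rewrite !(sorted_pairwise geq_trans) -cats1 !pairwise_cat.
  case/and3P => /allrelP mc -> _ /=; rewrite andbT; apply/allrelP=> x z xm.
  by rewrite inE => /eqP->; have := mc x c xm (mem_head _ _); rewrite /=; lia.
- by rewrite /l'; case: eqP; rewrite ?size_rcons.
- by rewrite /l' sumn_rcons; case: eqP => [->|c1]; rewrite ?sumn_rcons; lia.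
split=> // i; first by move=> mi; rewrite nth_c gtn_eqF // nth_default // ltnW.
rewrite nth_c /l'; case: eqP => [->|c1].
  by case: eqP => // ->; rewrite nth_default.
by rewrite nth_rcons; case: ltngtP => // lt; rewrite nth_default // ltnW.
Qed.

(** Induction on the total size: removing a cell of component j lowers a beta number of [phi la]
    from (y + 1) r + j to y r + j, which peels a ribbon of length r. *)
Lemma Par_r_phi la : all is_part la -> 0 < size la -> Par_r (size la) (phi la).
Proof.
move En : (sumn (map sumn la)) => n; elim: n la En => [|n IH] la En la_p la0.
  have := sumn_phi la_p la0; rewrite En muln0.
  have := phi_part la; case: (phi la) => [_ _|b l]; first exact: Par_r_nil.
  by case/andP=> _ /=; rewrite inE; case: b.
have sumE (ls : seq (seq nat)) : size ls = size la ->
    sumn (map sumn ls) = \sum_(i < size la) sumn (nth [::] ls i).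
  by move=> <-; rewrite sumnE big_map (big_nth [::]) big_mkord.
have [/existsP[j lj]|] := boolP [exists j : 'I_(size la), nth [::] la j != [::]]; last first.
  rewrite negb_exists => /forallP all0; move: En; rewrite sumE // big1 // => i _.
  by have := all0 i; rewrite negbK => /eqP->.
have lj_p : is_part (nth [::] la j) by apply: (allP la_p); apply: mem_nth.
have [l' [t [l'_p szl' suml' tl [l0 lt lE]]]] := part_remove_cell lj_p lj.
pose la2 := set_nth [::] la j l'.
have sz2 : size la2 = size la by rewrite size_set_nth; apply/maxn_idPr.
have nth2 i : nth [::] la2 i = if i == j then l' else nth [::] la i by rewrite nth_set_nth.
have la2_p : all is_part la2.
  apply/(all_nthP [::]) => i; rewrite sz2 nth2 => ir; case: ifP => // _.
  by apply: (allP la_p); apply: mem_nth.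
have En2 : sumn (map sumn la2) = n.
  apply: succn_inj; rewrite -En !sumE // (bigD1 j) // [in RHS](bigD1 j) //= nth2 eqxx.
  rewrite -addSn suml'; congr (_ + _); apply: eq_bigr => i ij.
  by rewrite nth2 ifN.
have la2_0 : 0 < size la2 by rewrite sz2.
pose a := \max_(l <- la) size l.
have sza l : l \in la -> size l <= a by move=> lla; rewrite (leq_bigmax_seq _ lla).
have sza2 l : l \in la2 -> size l <= a.
  move/(nthP [::]) => [i]; rewrite sz2 nth2 => ir <-; case: ifP => _.
    by rewrite (leq_trans szl') // sza // mem_nth.
  by rewrite sza // mem_nth.
have ta : t < a by rewrite (leq_trans tl) // sza // mem_nth.
have [y [y1 yn yE]] := betas_remove_cell (is_part_sorted lj_p) ta l0 lt lE.
have [szphi /perm_mem memphi] := betas_phi la_p la0 sza.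
have [szphi2 /perm_mem memphi2] := betas_phi la2_p la2_0 sza2.
have P2 := IH _ En2 la2_p la2_0; rewrite sz2 in P2 szphi2 memphi2.
apply: Par_r_peel P2; set r := size la in memphi memphi2 *.
have bE : y * r + j + r = y.+1 * r + j by rewrite mulSn; lia.
have divE z : (z * r + j) %/ r = z by rewrite divnMDl // divn_small ?addn0.
have modE z : (z * r + j) %% r = j by rewrite modnMDl modn_small.
have xE x z : (x == z * r + j) = (x %% r == j) && (x %/ r == z).
  apply/eqP/andP => [->|[/eqP xj /eqP <-]]; first by rewrite divE modE.
  by rewrite -xj -divn_eq.
apply: (@peel_betas r (r * a) _ _ (y * r + j)); rewrite ?phi_part //.
- by rewrite bE memphi mem_merged_betas // divE modE.
- by rewrite memphi mem_merged_betas // divE modE.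
move=> x; rewrite memphi memphi2 !mem_merged_betas // sz2 nth2 bE !xE.
case: eqP => [xj|_] /=; last by rewrite andbT orbF.
by rewrite yE xj.
Qed.

(** * Cycles and blocks *)

Section Cycles.
Variables (m : nat) (L : finType) (s : 'S_m) (mu : seq nat) (t : nat).
Hypotheses (s_mu : perm_eq (cycle_lengths s) mu) (szmu : size mu = t).

Lemma sum_fixed_words_cycles (F : {ffun L -> nat} -> algC) :
  (\sum_(h : {ffun 'I_m -> L} | word_act h s == h) F (content h) =
   \sum_(g : {ffun 'I_t -> L}) F [ffun l => \sum_(k | g k == l) nth 0 mu k]%N)%R.
Proof.
pose cyc := enum (porbits s).
(* The cycles are listed as [u] so that their lengths are mu in the given order; a fixed word is
   then a choice of one letter for each entry of mu. *)
have [Is pIs muE] := perm_iotaP 0 (etrans (perm_sym _ _) s_mu).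
rewrite size_map -/cyc in pIs; pose u := [seq nth set0 cyc i | i <- Is].
have pu : perm_eq u cyc by have := perm_map (nth set0 cyc) pIs; rewrite -/(mkseq _ _) mkseq_nth.
have uE : mu = [seq #|c| | c : {set 'I_m} <- u].
  rewrite muE -map_comp; apply/eq_in_map => i; rewrite (perm_mem pIs) mem_iota /= => ic.
  by rewrite /cycle_lengths (nth_map set0).
have uu : uniq u by rewrite (perm_uniq pu) enum_uniq.
have szu : size u = t by rewrite -szmu uE size_map.
have inu x : porbit s x \in u by rewrite (perm_mem pu) mem_enum imset_f.
have idxP x : index (porbit s x) u < t by rewrite -szu index_mem.
pose idx x := Ordinal (idxP x).
have idxE x (k : 'I_t) : (idx x == k) = (x \in nth set0 u k).
  have uk : nth set0 u k \in u by rewrite mem_nth // szu.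
  rewrite -(inj_eq val_inj) /=; apply/eqP/idP => [<-|].
    by rewrite nth_index // porbit_id.
  have : nth set0 u k \in cyc by rewrite -(perm_mem pu).
  rewrite mem_enum => /imsetP[y _ uy]; rewrite uy -eq_porbit_mem => /eqP->.
  by rewrite -uy index_uniq // szu.
have [rep repE] : exists rep : 'I_t -> 'I_m, forall k, idx (rep k) = k.
  apply: (@fin_all_exists _ (fun=> 'I_m) (fun k x => idx x = k)) => k.
  have : nth set0 u k \in cyc by rewrite -(perm_mem pu) mem_nth // szu.
  rewrite mem_enum => /imsetP[y _ uy]; exists y; apply/eqP.
  by rewrite idxE uy porbit_id.
pose H (g : {ffun 'I_t -> L}) : {ffun 'I_m -> L} := [ffun x => g (idx x)].
pose G (h : {ffun 'I_m -> L}) : {ffun 'I_t -> L} := [ffun k => h (rep k)].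
rewrite (reindex_onto H G) /= => [|h /eqP hs]; last first.
  apply/ffunP=> x; rewrite !ffunE.
  have : rep (idx x) \in porbit s x.
    have /eqP := repE (idx x); rewrite idxE nth_index //.
  case/porbitP=> i ->; elim: i => [|i IH]; first by rewrite perm1.
  by rewrite expgSr permM -[in RHS]IH -[in RHS]hs ffunE.
apply: eq_big => g.
  have -> : G (H g) == g by apply/eqP/ffunP=> k; rewrite !ffunE repE.
  rewrite andbT; apply/eqP/ffunP=> x; rewrite !ffunE; congr (g _).
  apply: val_inj => /=; congr (index _ u); apply/eqP.
  by rewrite eq_porbit_mem; apply: (mem_porbit s 1).
move=> _; congr F; apply/ffunP=> l; rewrite !ffunE.
rewrite (partition_big idx predT) //= [RHS]big_mkcond /=; apply: eq_bigr => k _.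
rewrite (eq_bigr (fun=> (g k == l) : nat)) => [|x /eqP <-]; last by rewrite ffunE.
rewrite sum_nat_const uE (nth_map set0) ?szu //.
have -> : #|[pred x | idx x == k]| = #|nth set0 u k|.
  by apply: eq_card => x; rewrite inE idxE.
by case: eqP; rewrite ?muln1 ?muln0.
Qed.
End Cycles.

(** * Determinants of block diagonal matrices with interleaved blocks *)

Section BlockDet.
Local Open Scope ring_scope.

Lemma det_mxsub_bij (R : comRingType) n m (f : 'I_n -> 'I_m) (A : 'M[R]_m) :
  bijective f -> \det (mxsub f f A) = \det A.
Proof.
move=> f_bij; have := bij_eq_card f_bij; rewrite !card_ord => nm.
move: f f_bij; rewrite nm => f f_bij.
have f_inj := bij_inj f_bij.
have -> : mxsub f f A = row_perm (perm f_inj) (col_perm (perm f_inj) A).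
  by apply/matrixP=> i j; rewrite !mxE !permE.
rewrite row_permE col_permE !det_mulmx !det_perm odd_permV mulrCA.
by rewrite -signr_addb addbb mulr1.
Qed.

Lemma det_blocks (R : comRingType) r b N (e : 'I_r * 'I_b -> 'I_N) (A : 'M[R]_N) :
  bijective e ->
  (forall p q, p.1 != q.1 -> A (e p) (e q) = 0) ->
  \det A = \prod_j \det (\matrix_(i, i') A (e (j, i)) (e (j, i'))).
Proof.
elim: r N e A => [|r IH] N e A e_bij A0.
  have := bij_eq_card e_bij; rewrite card_prod !card_ord mul0n => N0.
  by rewrite big_ord0; move: A {A0}; rewrite -N0 => A; rewrite det_mx00.
pose T := ('I_r * 'I_b)%type.
(* List block 0 first and then the union of the others, enumerated as one ordinal, so that
   [det_ublock] splits off one factor. *)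
pose f (k : 'I_(b + #|{: T}|)) : 'I_N := match split k with
  | inl i => e (ord0, i)
  | inr k' => e (lift ord0 (enum_val k').1, (enum_val k').2) end.
have e_inj := bij_inj e_bij.
have fl i : f (lshift _ i) = e (ord0, i) by rewrite /f (unsplitK (inl i)).
have fr k : f (rshift _ k) = e (lift ord0 (enum_val k).1, (enum_val k).2).
  by rewrite /f (unsplitK (inr k)).
have f_bij : bijective f.
  apply: inj_card_bij; last first.
    by rewrite -(bij_eq_card e_bij) !card_ord !card_prod !card_ord mulSn.
  move=> k k'; rewrite -[k]splitK -[k']splitK.
  case: (split k) => i; case: (split k') => i' /=; rewrite ?fl ?fr => /e_inj E.
  - by have /= -> := congr1 snd E.
  - by have := congr1 fst E.
  - by have := congr1 fst E.
  congr (rshift _ _); apply: enum_val_inj.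
  have /= E1 := lift_inj (congr1 fst E); have /= E2 := congr1 snd E.
  by rewrite [LHS]surjective_pairing [RHS]surjective_pairing E1 E2.
rewrite -(det_mxsub_bij _ f_bij) big_ord_recl.
have -> : mxsub f f A = block_mx (\matrix_(i, i') A (e (ord0, i)) (e (ord0, i'))) 0 0
   (\matrix_(k, k') A (f (rshift _ k)) (f (rshift _ k'))).
  apply/matrixP=> k k'; rewrite -[k]splitK -[k']splitK.
  case: (split k) => i; case: (split k') => i' /=.
  - by rewrite block_mxEul !mxE !fl.
  - by rewrite block_mxEur !mxE fl fr A0.
  - by rewrite block_mxEdl !mxE fl fr A0.
  - by rewrite block_mxEdr !mxE.
rewrite det_ublock; congr (_ * _).
rewrite (IH _ (fun p : T => enum_rank p)) => [|| p q pq].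
- apply: eq_bigr => j _; congr (\det _); apply/matrixP=> i i'.
  by rewrite !mxE !fr !enum_rankK.
- exact: enum_rank_bij.
by rewrite mxE !fr !enum_rankK A0 //= (inj_eq lift_inj).
Qed.
End BlockDet.

(** * The sorting permutation *)

Section Sign.
Variable r : nat.

(** The beta numbers of the components, recovered from lam alone ([residues_phi]); this is what
    makes the sign a function of [phi la]. *)
Definition residues (N : nat) (lam : seq nat) (j : nat) : seq nat :=
  [seq b %/ r | b <- betas N lam & b %% r == j].

(* With d = N - l.+1 the l-th entry of delta, position l is sent to that of the
   beta number of lam with the residue of d mod r and the same rank in its
   residue class. *)
Definition sort_fun (a : nat) (lam : seq nat) (l : 'I_(r * a)) : 'I_(r * a) :=
  let d := r * a - l.+1 in
  let b := nth 0 (residues (r * a) lam (d %% r)) (a - (d %/ r).+1) * r + d %% r in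
  odflt l [pick y : 'I_(r * a) | beta (r * a) lam y == b].

Definition sort_perm (a : nat) (lam : seq nat) : 'S_(r * a) :=
  perm_of_fun (@sort_fun a lam).

Variables (a : nat).
Hypothesis r_gt0 : 0 < r.

Lemma interleave_subproof (p : 'I_r * 'I_a) : (a - p.2.+1) * r + p.1 < r * a.
Proof.
case: p => j i /=; have jr := ltn_ord j; have ia := ltn_ord i.
rewrite (@leq_trans ((a - i.+1).+1 * r)) //; first by rewrite mulSn addnC ltn_add2r.
by rewrite mulnC leq_mul2l subnSK // leq_subr orbT.
Qed.

(* The index at which delta takes the value r * delta_i + j. *)
Definition interleave p : 'I_(r * a) := rev_ord (Ordinal (interleave_subproof p)).

Lemma interleaveE p : r * a - (interleave p).+1 = (a - p.2.+1) * r + p.1.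
Proof.
have := interleave_subproof p; rewrite /=.
by move: (_ * r + _) (r * a) => d N; lia.
Qed.

Lemma interleave_bij : bijective interleave.
Proof.
apply: inj_card_bij; last by rewrite card_prod !card_ord.
move=> [j i] [j' i'] /(congr1 (fun l : 'I_(r * a) => r * a - l.+1)).
rewrite !interleaveE /= => E.
have := congr1 (modn^~ r) E; rewrite !modnMDl !modn_small // => /val_inj ->.
have := congr1 (divn^~ r) E; rewrite !divnMDl // !divn_small // !addn0 => E'.
congr (_, _); apply: val_inj => /=; have := ltn_ord i; have := ltn_ord i'; lia.
Qed.

Variable la : seq (seq nat).
Hypotheses (sz_la : size la = r) (la_part : all is_part la).
Hypothesis sza : forall l, l \in la -> size l <= a.

Let la_gt0 : 0 < size la. Proof. by rewrite sz_la. Qed.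
Let lam_sorted : sorted geq (phi la). Proof. exact: is_part_sorted (phi_part la). Qed.

Lemma mem_betas_phi x :
  (x \in betas (r * a) (phi la)) = (x %/ r \in betas a (nth [::] la (x %% r))).
Proof.
have [_ /perm_mem] := betas_phi la_part la_gt0 sza.
by rewrite sz_la => ->; rewrite mem_merged_betas // sz_la.
Qed.

Lemma residues_phi j : j < r -> residues (r * a) (phi la) j = betas a (nth [::] la j).
Proof.
move=> jr; apply: (irr_sorted_eq gtn_trans) => [x /=||| y]; first by rewrite ltnn.
- have := sorted_betas (r * a) lam_sorted; rewrite !(sorted_pairwise gtn_trans).
  move/(pairwise_filter (fun b => b %% r == j)) => s; rewrite pairwise_map.
  apply: (sub_in_pairwise (P := fun b => b %% r == j)) s; last exact: filter_all.
  move=> x y /eqP xj /eqP yj /=.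
  by rewrite {1}(divn_eq x r) {1}(divn_eq y r) xj yj ltn_add2r ltn_mul2r r_gt0.
- by apply: sorted_betas; apply: nth_la_sorted.
apply/mapP/idP => [[b]|yb].
  by rewrite mem_filter => /andP[/eqP bj]; rewrite mem_betas_phi bj => + ->.
exists (y * r + j); last by rewrite divnMDl // divn_small ?addn0.
rewrite mem_filter mem_betas_phi modnMDl modn_small // eqxx /=.
by rewrite divnMDl // divn_small ?addn0.
Qed.

Lemma sort_fun_interleave p :
  beta (r * a) (phi la) (sort_fun (phi la) (interleave p)) =
  beta a (nth [::] la p.1) p.2 * r + p.1.
Proof.
rewrite /sort_fun interleaveE; case: p => j i /=.
rewrite modnMDl modn_small // divnMDl // divn_small // addn0 residues_phi //.
have -> : a - (a - i.+1).+1 = i by have := ltn_ord i; lia.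
rewrite nth_betas //; case: pickP => [y /eqP//|none].
have : beta a (nth [::] la j) i * r + j \in betas (r * a) (phi la).
  rewrite mem_betas_phi modnMDl modn_small // divnMDl // divn_small // addn0.
  by apply/mem_betasP; exists i.
by case/mem_betasP=> y yN E; have := none (Ordinal yN); rewrite /= -E eqxx.
Qed.

Lemma sort_permE p : sort_perm a (phi la) (interleave p) = sort_fun (phi la) (interleave p).
Proof.
rewrite /sort_perm perm_of_funE // => l l'.
have [g gK Kg] := interleave_bij; rewrite -[l]Kg -[l']Kg.
move: (g l) (g l') => [j i] [j' i'].
move/(congr1 (fun y : 'I_(r * a) => beta (r * a) (phi la) y)).
rewrite !sort_fun_interleave /= => E.
have := congr1 (modn^~ r) E; rewrite !modnMDl !modn_small // => /val_inj jj.
move: E; rewrite jj => /addIn /eqP; rewrite eqn_pmul2r // => /eqP ii.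
by rewrite (beta_inj (nth_la_sorted la_part j') ii).
Qed.

(** All contents being multiples of r, an entry of the sorted matrix can be nonzero only if its row
    and column have the same residue mod r; dividing by r then gives the corresponding entry for the
    component. *)
Lemma altcoef_phi (c' : {ffun 'I_(r * a) -> nat}) (c : {ffun 'I_r * 'I_a -> nat}) :
  (forall p, c' (interleave p) = r * c p) ->
  altcoef (phi la) c' = ((-1) ^+ sort_perm a (phi la) *
    \prod_(j < r) altcoef (nth [::] la j) [ffun i => c (j, i)])%R.
Proof.
move=> cE; rewrite /altcoef; set M := (\matrix_(i, j) _)%R.
have -> : (\det M = (-1) ^+ sort_perm a (phi la) *
    \det (col_perm (sort_perm a (phi la)) M))%R.
  by rewrite col_permE det_mulmx det_perm odd_permV mulrCA -signr_addb addbb mulr1.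
have ME p q : (col_perm (sort_perm a (phi la)) M (interleave p) (interleave q) =
    ((p.1 == q.1) && (c p + (a - p.2.+1) == beta a (nth [::] la q.1) q.2))%N%:R)%R.
  rewrite !mxE sort_permE sort_fun_interleave cE interleaveE.
  congr (nat_of_bool _)%:R%R; apply/eqP/andP=> [E|[/eqP-> /eqP <-]]; last first.
    by rewrite mulnDl addnA [r * _]mulnC.
  have {}E : (c p + (a - p.2.+1)) * r + p.1 = beta a (nth [::] la q.1) q.2 * r + q.1.
    by rewrite -E mulnDl addnA [r * _]mulnC.
  have := congr1 (modn^~ r) E; rewrite !modnMDl !modn_small // => /val_inj jj.
  by move: E; rewrite jj => /addIn /eqP; rewrite eqn_pmul2r // => ->.
rewrite (det_blocks interleave_bij) => [|p q /negbTE pq]; last by rewrite ME pq.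
congr (_ * _)%R; apply: eq_bigr => j _; congr (\det _)%R.
apply/matrixP=> i i'; rewrite !mxE; have := ME (j, i) (j, i').
by rewrite !mxE eqxx ffunE => ->.
Qed.
End Sign.

Section Types.
Local Open Scope ring_scope.
Variables (r n : nat) (p : {perm 'I_n * Zmod r}) (mu : seq nat).
Hypothesis p_mu : forall j : Zmod r,
  perm_eq (wcycle_lengths p j) (if j == 0 then mu else [::]).

Lemma color_cycle0 c : c \in porbits (base p) -> \sum_(i in c) color p i = 0.
Proof.
move=> cp; apply/eqP/negPn/negP => j0.
have := p_mu (\sum_(i in c) color p i); rewrite (negbTE j0) => /perm_nilP/eqP.
rewrite -size_eq0 size_map size_filter -leqn0 leqNgt -has_count.
by case/negP; apply/hasP; exists c; rewrite ?mem_enum /=.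
Qed.

Lemma cycle_lengths_base : perm_eq (cycle_lengths (base p)) mu.
Proof.
have := p_mu 0; rewrite eqxx /wcycle_lengths (@eq_in_filter _ _ predT) ?filter_predT //.
by move=> c; rewrite mem_enum /= => /color_cycle0->; rewrite eqxx.
Qed.
End Types.

(** * Comparison of the two word sums *)

Section Main.
Local Open Scope ring_scope.
Variables (r n : nat) (la : r.-tuple (seq nat)) (mu : seq nat).
Hypotheses (r_gt0 : (0 < r)%N) (la_multi : is_multipart n la).

Lemma sumn_phi_multi : sumn (phi la) = (r * n)%N.
Proof.
case/andP: la_multi => la_p /eqP sla.
by rewrite sumn_phi // ?size_tuple // sla.
Qed.

Lemma psi_chi (p : {perm 'I_n * Zmod r}) (s : 'S_(r * n)) :
  p \in wreath r n ->
  (forall j : Zmod r, perm_eq (wcycle_lengths p j) (if j == 0 then mu else [::])) ->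
  perm_eq (cycle_lengths s) [seq (r * k)%N | k <- mu] ->
  psi n la p = (-1) ^+ sort_perm r (sumn (phi la)).+1 (phi la) * chi (r * n) (phi la) s.
Proof.
move=> pW p_mu s_mu; case/andP: (la_multi) => la_p /eqP sla.
rewrite sumn_phi_multi; set a := (r * n)%N.
have size_le_sumn l : is_part l -> (size l <= sumn l)%N.
  case/andP=> _; elim: l => //= b l IH.
  by rewrite inE negb_or eq_sym -lt0n => /andP[b0 /IH]; lia.
have sza l : l \in (la : seq _) -> (size l <= a.+1)%N.
  move=> lla; have := allP la_p _ lla => /size_le_sumn sl.
  have : (sumn l <= n)%N.
    rewrite -sla [leqRHS]sumnE big_map; move: lla; move: (la : seq _) => ls.
    by move=> lls; rewrite (big_rem l lls) leq_addr.
  by move=> ln; rewrite leqW // (leq_trans sl) // (leq_trans ln) // leq_pmull.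
have szt j : (size (tnth la j) <= a.+1)%N by apply: sza; apply: mem_tnth.
have sz_la : size la = r by rewrite size_tuple.
have la0 : (0 < size la)%N by rewrite sz_la.
pose e := @interleave r a.+1.
rewrite (psi_words la_multi szt pW (color_cycle0 p_mu)).
pose F (c : {ffun 'I_r * 'I_a.+1 -> nat}) := \prod_j altcoef (tnth la j) (subcontent c j).
rewrite (sum_fixed_words_cycles (cycle_lengths_base p_mu) (erefl _) F).
have [szphi _] := betas_phi la_p la0 sza; rewrite sz_la in szphi.
rewrite (chi_altcoef s (is_part_sorted (phi_part la)) sumn_phi_multi szphi).
rewrite (sum_fixed_words_cycles s_mu (size_map _ _) (altcoef (phi la))).
have [e' eK e'K] := @interleave_bij r a.+1 r_gt0.
(* Both sides are now sums over assignments of letters to the entries of mu; the pair (j, i) is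
   identified with the letter at which delta is r delta_i + j, and the content gets multiplied by
   r. *)
pose E (g : {ffun 'I_(size mu) -> 'I_r * 'I_a.+1}) :
    {ffun 'I_(size mu) -> 'I_(r * a.+1)} :=
  [ffun k => e (g k)].
have E_bij : bijective E.
  exists (fun g : {ffun 'I_(size mu) -> 'I_(r * a.+1)} => [ffun k => e' (g k)]) => g;
    by apply/ffunP=> k; rewrite !ffunE ?eK ?e'K.
rewrite [in RHS](reindex E) /=; last exact: onW_bij.
rewrite mulr_sumr; apply: eq_bigr => g _.
rewrite (altcoef_phi r_gt0 sz_la la_p sza
  (c := [ffun l => \sum_(k | g k == l) nth 0 mu k]%N)) => [|l].
  rewrite mulrA -signr_addb addbb mul1r; apply: eq_bigr => j _.
  by rewrite (tnth_nth [::]); congr altcoef; apply/ffunP=> i; rewrite !ffunE.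
rewrite !ffunE big_distrr /=; apply: eq_big => k.
  by rewrite ffunE (can_eq eK).
by move=> _; rewrite (nth_map 0%N).
Qed.
End Main.

Theorem theorem3p1 (r : nat) (r_gt0 : (0 < r)%N) :
  exists sign : seq nat -> int,
    (forall la : seq nat, Par_r r la -> sign la = 1%R \/ sign la = (-1)%R) /\
    forall (n : nat) (la : r.-tuple (seq nat)) (mu : seq nat),
      (0 < n)%N -> is_multipart n la -> is_composition n mu ->
      Par_r r (phi la) /\
      forall (p : {perm 'I_n * Zmod r}) (s : 'S_(r * n)),
        p \in wreath r n ->
        (forall j : Zmod r,
           perm_eq (wcycle_lengths p j) (if j == 0%R then mu else [::])) ->
        perm_eq (cycle_lengths s) [seq (r * m)%N | m <- mu] ->
        psi n la p = ((sign (phi la))%:~R * chi (r * n) (phi la) s)%R.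
Proof.
(* The argument alone determines the number of letters, through [sumn la], and [perm_of_fun] makes
   [sort_perm] a permutation for every la. *)
exists (fun la => (-1) ^+ sort_perm r (sumn la).+1 la)%R; split.
  by move=> la _; case: odd_perm; [right | left].
move=> n la mu _ la_multi _; have [la_p _] := andP la_multi; split.
  by have := Par_r_phi la_p; rewrite size_tuple; apply.
move=> p s pW p_mu s_mu; rewrite (psi_chi r_gt0 la_multi pW p_mu s_mu).
by rewrite rmorph_sign.
Qed.
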